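(* Let $\beta,\gamma\in\mathbb{C}$ with $\gamma\notin\mathbb{Z}$ and $(\beta-1)(\beta-\gamma)\neq 0$, and fix $\eta\in(0,\frac{\pi}{2})$. Let the Gauss solutions $y_j^{(1)},y_j^{(\infty)}$ (depending on $\alpha$), the Kummer solutions $\tilde y_j^{(\infty,k)}$, and the sectors $\sigma_\alpha(\alpha)$, $\sigma_\infty(\alpha)$, $\widetilde{\mathscr S}_k$ be as defined in the context. Suppose that, for $j\in\{1,2\}$, $k_{j,1}^{\pm}(\alpha)$ and $k_{j,\infty}^{\pm}(\alpha)$ are scalars (superscript $+$ for $\alpha$ on the ray $\arg(\alpha)=\frac{\pi}{2}$, superscript $-$ for $\alpha$ on the ray $\arg(\alpha)=-\frac{\pi}{2}$) such that for $j=1,2$ $$\lim_{\substack{\alpha\to\infty\\ \arg(\alpha)=-\frac{\pi}{2}}} y_j^{(1)}(z\alpha^{-1})\big|_{z\in\sigma_\alpha(\alpha)}\,k_{j,1}^{-}(\alpha)=\tilde y_j^{(\infty,-1)}(z)\quad\text{uniformly for } z\in\widetilde{\mathscr S}_{-1},$$ $$\lim_{\substack{\alpha\to\infty\\ \arg(\alpha)=-\frac{\pi}{2}}} y_j^{(\infty)}(z\alpha^{-1})\big|_{z\in\sigma_\infty(\alpha)}\,k_{j,\infty}^{-}(\alpha)=\tilde y_j^{(\infty,0)}(z)\quad\text{uniformly for } z\in\widetilde{\mathscr S}_{0},$$ $$\lim_{\substack{\alpha\to\infty\\ \arg(\alpha)=\frac{\pi}{2}}} y_j^{(1)}(z\alpha^{-1})\big|_{z\in\sigma_\alpha(\alpha)}\,k_{j,1}^{+}(\alpha)=\tilde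 y_j^{(\infty,0)}(z)\quad\text{uniformly for } z\in\widetilde{\mathscr S}_{0},$$ $$\lim_{\substack{\alpha\to\infty\\ \arg(\alpha)=\frac{\pi}{2}}} y_j^{(\infty)}(z\alpha^{-1})\big|_{z\in\sigma_\infty(\alpha)}\,k_{j,\infty}^{+}(\alpha)=\tilde y_j^{(\infty,1)}(z)\quad\text{uniformly for } z\in\widetilde{\mathscr S}_{1}.$$ Then, for each choice of sign, $$\lim_{\substack{\alpha\to\infty\\ \arg(\alpha)=\pm\frac{\pi}{2}}} k_{1,\infty}^{\pm}(\alpha)\,(-\alpha)^{\gamma-\beta}=1,\qquad \lim_{\substack{\alpha\to\infty\\ \arg(\alpha)=\pm\frac{\pi}{2}}} -k_{2,\infty}^{\pm}(\alpha)\,(-\alpha)^{\beta}=1,$$ $$\lim_{\substack{\alpha\to\infty\\ \arg(\alpha)=\pm\frac{\pi}{2}}} k_{1,1}^{\pm}(\alpha)\,\alpha^{\gamma-\beta}=1,\qquad \lim_{\substack{\alpha\to\infty\\ \arg(\alpha)=\pm\frac{\pi}{2}}} -k_{2,1}^{\pm}(\alpha)\,\alpha^{\beta}=1,$$ where powers of $\alpha$ are computed with $\arg(\alpha)=\pm\frac{\pi}{2}$ and powers of $-\alpha$ with $-\alpha=\alpha e^{i\pi}$, i.e. $\arg(-\alpha)=\arg(\alpha)+\pi$.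
   Context: The Gauss equation is $x(1-x)y''+(\gamma-(\alpha+\beta+1)x)y'-\alpha\beta y=0$. It is assumed non-resonant: $\gamma,\ \gamma-\alpha-\beta,\ \alpha-\beta\notin\mathbb{Z}$ (for $\alpha$ on the rays $\arg\alpha=\pm\frac{\pi}{2}$ the last two hold once $|\alpha|$ is large). Its local solutions at $x=1$ and $x=\infty$ are $$y_1^{(1)}(x)=(1-x)^{\gamma-\alpha-\beta}\,{}_2F_1(\gamma-\alpha,\gamma-\beta;\gamma+1-\alpha-\beta;1-x),\quad y_2^{(1)}(x)={}_2F_1(\alpha,\beta;\alpha+\beta+1-\gamma;1-x)$$ for $|x-1|<1$, $-\pi\le\arg(1-x)<\pi$, and $$y_1^{(\infty)}(x)=(-x)^{-\alpha}\,{}_2F_1(\alpha,\alpha+1-\gamma;\alpha+1-\beta;x^{-1}),\quad y_2^{(\infty)}(x)=(-x)^{-\beta}\,{}_2F_1(\beta,\beta+1-\gamma;\beta+1-\alpha;x^{-1})$$ for $|x|>1$, $-\pi\le\arg(-x)<\pi$. The Kummer equation is $z\tilde y''+(\gamma-z)\tilde y'-\beta\tilde y=0$. For $k\in\mathbb{Z}$ let $\widetilde\Sigma_k=\{z: -\frac{\pi}{2}<\arg(z)-k\pi<\frac{3\pi}{2}\}$, a sector on the Riemann surface of the logarithm. $\tilde y_1^{(\infty,k)},\tilde y_2^{(\infty,k)}$ denote the unique solutions of the Kummer equation, analytic in $\widetilde\Sigma_k$, with the asymptotic expansions $$\tilde y_1^{(\infty,k)}(z)\sim e^{z}z^{\beta-\gamma}\sum_{n\ge0}\frac{(\gamma-\beta)_n(1-\beta)_n}{n!}z^{-n},\qquad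 \tilde y_2^{(\infty,k)}(z)\sim -z^{-\beta}\sum_{n\ge0}\frac{(\beta)_n(\beta+1-\gamma)_n}{n!}(-z)^{-n}$$ as $z\to\infty$ in $\widetilde\Sigma_k$, where $(a)_n=a(a+1)\cdots(a+n-1)$. Sectors: $\widetilde{\mathscr S}_k=\{z:\arg(z)-k\pi\in(\eta-\frac{\pi}{2},\frac{3\pi}{2}-\eta)\}$, $$\sigma_\alpha(\alpha)=\{z: |1-\tfrac{\alpha}{z}|<|\alpha|^2,\ \arg(\tfrac{z}{\alpha})\in(\eta-\pi,\pi-\eta),\ \arg(1-\tfrac{z}{\alpha})\in(\eta-\pi,\pi-\eta)\},$$ $$\sigma_\infty(\alpha)=\{z:\arg(-\tfrac{z}{\alpha})\in(\eta-\pi,\pi-\eta),\ \arg(1-\tfrac{z}{\alpha})\in(\eta-\pi,\pi-\eta)\}.$$ Here $\arg(z/\alpha)=\arg z-\arg\alpha$ and $\arg(-z/\alpha)=\arg z-\arg\alpha-\pi$, which fixes how points of $\sigma_\alpha(\alpha)$, $\sigma_\infty(\alpha)$ correspond to points of $\widetilde{\mathscr S}_k$. With these conventions, as $\alpha\to\infty$ with $\arg\alpha=-\frac{\pi}{2}$, $\sigma_\alpha(\alpha)$ and $\sigma_\infty(\alpha)$ tend to $\widetilde{\mathscr S}_{-1}$ and $\widetilde{\mathscr S}_0$; with $\arg\alpha=\frac{\pi}{2}$ they tend to $\widetilde{\mathscr S}_0$ and $\widetilde{\mathscr S}_1$ (in the limit the modulus condition becomes $|z|>0$ and the condition on $\arg(1-z/\alpha)$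 plays no role). The notation $y_j^{(1)}(z\alpha^{-1})|_{z\in\sigma_\alpha(\alpha)}$ (resp. $y_j^{(\infty)}(z\alpha^{-1})|_{z\in\sigma_\infty(\alpha)}$) means the analytic continuation of $y_j^{(1)}(x)$ from $x$ near $1$ (resp. of $y_j^{(\infty)}(x)$ from $x$ near $\infty$), with $x=z/\alpha$, to all $z\in\sigma_\alpha(\alpha)$ (resp. $z\in\sigma_\infty(\alpha)$). *)

(* Defs.v *)
(* Stdlib reals and Coquelicot *)
From Stdlib Require Export Reals Lra ZArith List.
From Coquelicot Require Export Coquelicot.
Open Scope R_scope.

Inductive index := first | second.
Inductive ray_sign := plus_ray | minus_ray.

Definition Cexp (w : C) : C := (exp (Re w) * cos (Im w), exp (Re w) * sin (Im w)).

(* Branch -PI <= Carg x < PI: on the negative real axis the value is -PI.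
   Meaningless at x = 0. *)
Definition Carg (x : C) : R :=
  if Rlt_dec 0 (Im x) then acos (Re x / Cmod x) else - acos (Re x / Cmod x).

Definition Clog (x : C) : C := (ln (Cmod x), Carg x).

Definition Cpower (x a : C) : C := Cexp (a * Clog x).

Lemma Carg_bounds (x : C) : x <> 0 -> - PI <= Carg x < PI.
Proof.
intros Hx. unfold Carg.
pose proof (acos_bound (Re x / Cmod x)) as Hb. pose proof PI_RGT_0 as Hp.
destruct (Rlt_dec 0 (Im x)) as [Hi|Hi]; [|lra].
split; [lra|].
assert (H0 : 0 < Cmod x) by now apply Cmod_gt_0.
destruct (Rle_lt_or_eq_dec _ _ (proj2 Hb)) as [H|H]; [exact H|exfalso].
pose proof (Cmod2_alt x) as H2.
assert (Hq : -1 <= Re x / Cmod x <= 1).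
{ pose proof (re_le_Cmod x) as Hr. apply Rabs_le_between in Hr.
  split; [apply Rle_div_r | apply Rle_div_l]; lra. }
assert (Hc : cos (acos (Re x / Cmod x)) = Re x / Cmod x) by now apply cos_acos.
rewrite H, cos_PI in Hc.
assert (Hr : Re x = - Cmod x).
{ replace (Re x) with (Re x / Cmod x * Cmod x) by (field; lra). rewrite <- Hc; ring. }
rewrite Hr in H2. nra.
Qed.

Lemma Cexp_Clog (x : C) : x <> 0 -> Cexp (Clog x) = x.
Proof.
intros Hx.
assert (H0 : 0 < Cmod x) by now apply Cmod_gt_0.
pose proof (Cmod2_alt x) as H2.
assert (Hq : -1 <= Re x / Cmod x <= 1).
{ pose proof (re_le_Cmod x) as Hr. apply Rabs_le_between in Hr.
  split; [apply Rle_div_r | apply Rle_div_l]; lra. }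
assert (Hs : sqrt (1 - (Re x / Cmod x)²) = Rabs (Im x) / Cmod x).
{ apply sqrt_lem_1.
  - pose proof (Rsqr_bounds_le 1 (Re x / Cmod x) Hq) as Hb.
    rewrite Rsqr_1 in Hb; lra.
  - apply Rdiv_le_0_compat; [apply Rabs_pos|lra].
  - replace (Rabs (Im x) / Cmod x * (Rabs (Im x) / Cmod x))
      with ((Rabs (Im x))² / Cmod x ^ 2) by (unfold Rsqr; field; lra).
    rewrite <- Rsqr_abs.
    replace (1 - (Re x / Cmod x)²) with ((Cmod x ^ 2 - Re x ^ 2) / Cmod x ^ 2)
      by (unfold Rsqr; field; lra).
    replace (Cmod x ^ 2 - Re x ^ 2) with (Im x)² by (rewrite H2; unfold Rsqr; ring).
    reflexivity. }
unfold Cexp, Clog; simpl.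
rewrite exp_ln by assumption.
apply injective_projections; simpl; unfold Carg.
- destruct (Rlt_dec 0 (Im x)); rewrite ?cos_neg, cos_acos by assumption;
    change (fst x) with (Re x); field; lra.
- destruct (Rlt_dec 0 (Im x)) as [Hi|Hi];
    rewrite ?sin_neg, sin_acos, Hs by assumption; change (snd x) with (Im x).
  + rewrite Rabs_right by lra. field; lra.
  + rewrite Rabs_left1 by lra. field; lra.
Qed.

(* A point z of the surface is encoded by its logarithm log|z| + i arg z, so
   [Lsurf] is all of C, multiplication on the surface is addition of codes, and
   functions on the surface are functions C -> C of the code.  Since the code is
   a global conformal coordinate, "analytic in z" is "analytic in the code". *)
Notation Lsurf := C (only parsing).

Definition pt (z : Lsurf) : C := Cexp z.
Definition modulus (z : Lsurf) : R := exp (Re z).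
Definition arg (z : Lsurf) : R := Im z.
Definition Lpow (z : Lsurf) (a : C) : C := Cexp (a * z).

(* z * e^{i theta} *)
Definition rotate (theta : R) (z : Lsurf) : Lsurf := (z + Ci * theta)%C.

Definition analytic_on (S : C -> Prop) (f : C -> C) : Prop :=
  forall z0 : C, S z0 ->
    exists (a : nat -> C) (r : R), 0 < r /\
      forall z : C, Cmod (z - z0) < r ->
        @is_pseries C_AbsRing C_NormedModule a (z - z0)%C (f z).

(* dy/dz = l at the point z of the surface: with w = log z the code of z,
   dy/dw = z dy/dz. *)
Definition is_dz (y : Lsurf -> C) (z : Lsurf) (l : C) : Prop :=
  @is_derive C_AbsRing C_NormedModule y z (pt z * l)%C.

Fixpoint poch (a : C) (n : nat) : C :=
  match n with
  | O => 1
  | S m => poch a m * (a + INR m)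
  end%C.

Definition CSeries (u : nat -> C) : C :=
  (Series (fun n => Re (u n)), Series (fun n => Im (u n))).

Definition hyp2F1 (a b c x : C) : C :=
  CSeries (fun n => poch a n * poch b n / (poch c n * INR (fact n)) * x ^ n)%C.

Definition nonresonant (alpha beta gamma : C) : Prop :=
  forall n : Z, gamma <> IZR n /\ (gamma - alpha - beta)%C <> IZR n
                /\ (alpha - beta)%C <> IZR n.

(* y_j^{(1)}(x), for |x - 1| < 1 *)
Definition gauss_1 (alpha beta gamma : C) (j : index) (x : C) : C :=
  match j with
  | first => Cpower (1 - x) (gamma - alpha - beta)
             * hyp2F1 (gamma - alpha) (gamma - beta) (gamma + 1 - alpha - beta) (1 - x)
  | second => hyp2F1 alpha beta (alpha + beta + 1 - gamma) (1 - x)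
  end%C.

(* y_j^{(infinity)}(x), for |x| > 1 *)
Definition gauss_infty (alpha beta gamma : C) (j : index) (x : C) : C :=
  match j with
  | first => Cpower (- x) (- alpha)
             * hyp2F1 alpha (alpha + 1 - gamma) (alpha + 1 - beta) (/ x)
  | second => Cpower (- x) (- beta)
             * hyp2F1 beta (beta + 1 - gamma) (beta + 1 - alpha) (/ x)
  end%C.

(* [pt z <> pt alpha] is implicit in the existence of arg (1 - z/alpha).  The
   latter is the argument of a complex number; the bounds keep it off the cut
   of [Carg]. *)
Definition sigma_alpha (eta : R) (alpha z : Lsurf) : Prop :=
  pt z <> pt alpha
  /\ Cmod (1 - pt alpha / pt z) < Cmod (pt alpha) ^ 2
  /\ eta - PI < arg z - arg alpha < PI - eta
  /\ eta - PI < Carg (1 - pt z / pt alpha) < PI - eta.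

Definition sigma_infty (eta : R) (alpha z : Lsurf) : Prop :=
  pt z <> pt alpha
  /\ eta - PI < arg z - arg alpha - PI < PI - eta
  /\ eta - PI < Carg (1 - pt z / pt alpha) < PI - eta.

(* Y is z |-> y_j^{(1)}(z/alpha) continued from z/alpha near 1 to sigma_alpha. *)
Definition gauss_1_continuation (eta : R) (beta gamma : C) (j : index)
    (alpha : Lsurf) (Y : Lsurf -> C) : Prop :=
  analytic_on (sigma_alpha eta alpha) Y
  /\ forall z : Lsurf, sigma_alpha eta alpha z -> Cmod (pt z / pt alpha - 1) < 1 ->
       Y z = gauss_1 (pt alpha) beta gamma j (pt z / pt alpha)%C.

Definition gauss_infty_continuation (eta : R) (beta gamma : C) (j : index)
    (alpha : Lsurf) (Y : Lsurf -> C) : Prop :=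
  analytic_on (sigma_infty eta alpha) Y
  /\ forall z : Lsurf, sigma_infty eta alpha z -> 1 < Cmod (pt z / pt alpha) ->
       Y z = gauss_infty (pt alpha) beta gamma j (pt z / pt alpha)%C.

Definition kummer_equation_on (beta gamma : C) (S : Lsurf -> Prop) (y : Lsurf -> C)
    : Prop :=
  exists y' y'' : Lsurf -> C, forall z : Lsurf, S z ->
    is_dz y z (y' z) /\ is_dz y' z (y'' z)
    /\ (pt z * y'' z + (gamma - pt z) * y' z - beta * y z)%C = 0.

Definition Sigma_tilde (k : Z) (z : Lsurf) : Prop :=
  - (PI / 2) < arg z - IZR k * PI < 3 * PI / 2.

Definition S_tilde (eta : R) (k : Z) (z : Lsurf) : Prop :=
  eta - PI / 2 < arg z - IZR k * PI < 3 * PI / 2 - eta.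

(* y ~ g(z) * sum_n a_n z^{-n} as z -> infinity in the open sector
   lo < arg z < hi, in the sense of Poincare: uniformly on closed subsectors. *)
Definition asymptotic_in_sector (lo hi : R) (y g : Lsurf -> C) (a : nat -> C) : Prop :=
  forall (t1 t2 : R), lo < t1 -> t2 < hi ->
  forall N : nat, exists B M : R, forall z : Lsurf,
    t1 <= arg z <= t2 -> M < modulus z ->
    Cmod (y z / g z - sum_n (fun n => a n / pt z ^ n)%C N) <= B / modulus z ^ S N.

Definition kummer_prefactor (beta gamma : C) (j : index) (z : Lsurf) : C :=
  match j with
  | first => Cexp (pt z) * Lpow z (beta - gamma)
  | second => - Lpow z (- beta)
  end%C.

Definition kummer_coef (beta gamma : C) (j : index) (n : nat) : C :=
  match j with
  | first => poch (gamma - beta) n * poch (1 - beta) n / INR (fact n)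
  | second => poch beta n * poch (beta + 1 - gamma) n / INR (fact n) * (- 1) ^ n
  end%C.

(* These properties determine the function on Sigma_tilde k. *)
Definition kummer_solution (beta gamma : C) (j : index) (k : Z) (y : Lsurf -> C)
    : Prop :=
  analytic_on (Sigma_tilde k) y
  /\ kummer_equation_on beta gamma (Sigma_tilde k) y
  /\ asymptotic_in_sector (IZR k * PI - PI / 2) (IZR k * PI + 3 * PI / 2) y
       (kummer_prefactor beta gamma j) (kummer_coef beta gamma j).

Definition ray_arg (s : ray_sign) : R :=
  match s with plus_ray => PI / 2 | minus_ray => - (PI / 2) end.

Definition ray_infty (s : ray_sign) : (Lsurf -> Prop) -> Prop :=
  fun P => exists M : R, forall alpha : Lsurf,
    arg alpha = ray_arg s -> M < modulus alpha -> P alpha.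

Global Instance ray_infty_proper (s : ray_sign) : ProperFilter (ray_infty s).
Proof.
split.
- intros P [M HM].
  exists (ln (Rmax M 0 + 1), ray_arg s). apply HM; [reflexivity|].
  pose proof (Rmax_l M 0). pose proof (Rmax_r M 0).
  unfold modulus; simpl. rewrite exp_ln; lra.
- split.
  + exists 0; easy.
  + intros P Q [M HM] [N HN]. exists (Rmax M N). intros alpha Ha Hm.
    pose proof (Rmax_l M N). pose proof (Rmax_r M N).
    split; [apply HM|apply HN]; try assumption; lra.
  + intros P Q HPQ [M HM]. exists M. auto.
Qed.

Definition compact_set (K : C -> Prop) : Prop :=
  forall F : (C -> Prop) -> Prop,
    (forall U, F U -> open U) ->
    (forall z, K z -> exists U, F U /\ U z) ->
    exists l : list (C -> Prop),
      (forall U, In U l -> F U) /\ (forall z, K z -> exists U, In U l /\ U z).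

(* Y alpha, defined on the alpha-dependent domain D alpha, tends to y as
   alpha -> infinity along the ray, uniformly on the compact subsets of the
   limit domain S.  Uniformity on all of an unbounded sector is not meant: it
   fails for the solutions behaving like e^z, because at fixed alpha the Gauss
   solutions grow at most polynomially. *)
Definition uniform_limit (s : ray_sign) (D : Lsurf -> Lsurf -> Prop) (S : Lsurf -> Prop)
    (Y : Lsurf -> Lsurf -> C) (y : Lsurf -> C) : Prop :=
  forall K : Lsurf -> Prop, compact_set K -> (forall z, K z -> S z) ->
  forall eps : R, 0 < eps ->
    ray_infty s (fun alpha =>
      forall z, K z -> D alpha z -> Cmod (Y alpha z - y z) < eps).

(* Main.v *)
(* On the ray z/alpha < 0 (for the solutions at infinity) or 0 < z/alpha < 1 (for those
   at 1) every Gauss solution is an elementary factor times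
   F(w) = 2F1(a, b; c; -w), with a, b independent of alpha, c = +-alpha + const, and
   w of size |alpha| / |z|.  The function F solves
     w (1 + w) F'' + (c + (a + b + 1) w) F' + a b F = 0,
   and F(w) = 1 + O(w / |Im c|) = 1 + O(1 / |z|) uniformly in alpha: the auxiliary function
   H = F' + a b F / (c + (a + b + 1) w) satisfies a first-order equation whose homogeneous
   part is dissipative when Re c >= 0 and Re (a + b + 1) >= 0.  The elementary factors are
   exactly the prefactors in the theorem times the Kummer prefactor, up to a factor
   tending to 1 with alpha.  Comparing with the Kummer asymptotics at |z| = R, first
   alpha -> infinity and then R -> infinity, gives the limits. *)
Require Import Defs.
From Stdlib Require Import Lia Psatz.
Open Scope R_scope.

(** * Calculus of functions R -> C *)

(** The comparison is made at fixed [|z| = R] while [|alpha|] grows, so [z / alpha] tends to 0 and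
    [w] grows like [|alpha| / R]. The series at infinity converges only for [|z| > |alpha|]: it
    needs an exact continuation along the whole ray, supplied by Pfaff's transformation and
    uniqueness for the Gauss equation. The estimate must then hold on an interval of [w] whose
    length is a small multiple of [|Im c|]. The coefficient [c / (w (1 + w))] is large with [alpha]
    and singular at [w = 0], so a Gronwall bound by absolute values is useless; only the sign of its
    real part can be exploited. This is where the rays [arg alpha = +-PI/2] enter: there [alpha] is
    purely imaginary, [Re c] is constant, and only [Im c] grows. In the first solution at infinity
    [alpha] also occurs in the numerator parameters. Euler's transformation moves it into a power of
    [1 - z / alpha] with exponent [gamma - beta - alpha], which is the origin of [e^z]. The two rays
    of comparison are the bisectors [arg z = k PI + PI/2] of the limit sectors, and one point of
    them for each [R] is enough. *)

Definition is_cderiv (f : R -> C) (x : R) (l : C) : Prop :=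
  is_derive (fun t => Re (f t)) x (Re l) /\ is_derive (fun t => Im (f t)) x (Im l).

Lemma Re_mult (a b : C) : Re (a * b)%C = Re a * Re b - Im a * Im b.
Proof. reflexivity. Qed.

Lemma Im_mult (a b : C) : Im (a * b)%C = Re a * Im b + Im a * Re b.
Proof. reflexivity. Qed.

Lemma C_eq (a b : C) : Re a = Re b -> Im a = Im b -> a = b.
Proof. destruct a, b; simpl; congruence. Qed.

Lemma Cmod_le_Re_Im (a : C) : Cmod a <= Rabs (Re a) + Rabs (Im a).
Proof.
pose proof (Cmod2_alt a) as H. pose proof (Cmod_ge_0 a).
pose proof (Rabs_pos (Re a)). pose proof (Rabs_pos (Im a)).
rewrite <- (pow2_abs (Re a)), <- (pow2_abs (Im a)) in H.
apply Rnot_lt_le; intros Hc. nra.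
Qed.

Lemma Im_le_Cmod (a : C) : Rabs (Im a) <= Cmod a.
Proof.
apply Rle_trans with (2 := Rmax_Cmod a). apply Rmax_r.
Qed.

Lemma is_cderiv_eq (f : R -> C) x l l' : is_cderiv f x l -> l = l' -> is_cderiv f x l'.
Proof. now intros H <-. Qed.

Lemma is_cderiv_ext_loc (f g : R -> C) x l :
  locally x (fun t => f t = g t) -> is_cderiv f x l -> is_cderiv g x l.
Proof.
intros He [H1 H2]; split.
- apply is_derive_ext_loc with (2 := H1). revert He; apply filter_imp; now intros t ->.
- apply is_derive_ext_loc with (2 := H2). revert He; apply filter_imp; now intros t ->.
Qed.

Lemma is_cderiv_const (a : C) x : is_cderiv (fun _ => a) x 0.
Proof. split; apply @is_derive_const. Qed.

Lemma is_cderiv_RtoC (f : R -> R) x l : is_derive f x l -> is_cderiv (fun t => RtoC (f t)) x l.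
Proof. intros H; split; [exact H | exact (is_derive_const 0 x)]. Qed.

Lemma is_cderiv_id x : is_cderiv (fun t => RtoC t) x 1.
Proof. exact (is_cderiv_RtoC (fun t => t) x 1 (is_derive_id x)). Qed.

Lemma is_cderiv_plus (f g : R -> C) x lf lg :
  is_cderiv f x lf -> is_cderiv g x lg -> is_cderiv (fun t => f t + g t)%C x (lf + lg)%C.
Proof. intros [A B] [A' B']; split; now apply @is_derive_plus. Qed.

Lemma is_cderiv_opp (f : R -> C) x lf :
  is_cderiv f x lf -> is_cderiv (fun t => - f t)%C x (- lf)%C.
Proof. intros [A B]; split; now apply @is_derive_opp. Qed.

Lemma is_cderiv_minus (f g : R -> C) x lf lg :
  is_cderiv f x lf -> is_cderiv g x lg -> is_cderiv (fun t => f t - g t)%C x (lf - lg)%C.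
Proof. intros H H'. apply is_cderiv_plus; [easy|]. now apply is_cderiv_opp. Qed.

Lemma is_derive_Rmult (f g : R -> R) x lf lg :
  is_derive f x lf -> is_derive g x lg ->
  is_derive (fun t => f t * g t) x (lf * g x + f x * lg).
Proof.
intros Hf Hg. exact (is_derive_mult f g x lf lg Hf Hg Rmult_comm).
Qed.

Lemma is_cderiv_mult (f g : R -> C) x lf lg :
  is_cderiv f x lf -> is_cderiv g x lg ->
  is_cderiv (fun t => f t * g t)%C x (lf * g x + f x * lg)%C.
Proof.
intros [A B] [A' B']; split.
- evar_last.
  { apply @is_derive_minus; apply is_derive_Rmult; eassumption. }
  unfold minus, plus, opp, Re, Im; simpl; ring.
- evar_last.
  { apply @is_derive_plus; apply is_derive_Rmult; eassumption. }
  unfold minus, plus, opp, Re, Im; simpl; ring.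
Qed.

Lemma is_cderiv_scal (k : C) (f : R -> C) x lf :
  is_cderiv f x lf -> is_cderiv (fun t => k * f t)%C x (k * lf)%C.
Proof.
intros H. eapply is_cderiv_eq.
- apply is_cderiv_mult; [apply is_cderiv_const | exact H].
- cbv beta; ring.
Qed.

Lemma is_cderiv_comp (f : R -> C) (g : R -> R) x lf lg :
  is_cderiv f (g x) lf -> is_derive g x lg -> is_cderiv (fun t => f (g t)) x (lg * lf)%C.
Proof.
intros [A B] H; split.
- evar_last. { apply (is_derive_comp (fun t => Re (f t)) g x _ _ A H). }
  unfold scal; simpl; unfold mult, Re, Im; simpl; ring.
- evar_last. { apply (is_derive_comp (fun t => Im (f t)) g x _ _ B H). }
  unfold scal; simpl; unfold mult, Re, Im; simpl; ring.
Qed.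

Lemma is_cderiv_Cexp (f : R -> C) x l :
  is_cderiv f x l -> is_cderiv (fun t => Cexp (f t)) x (l * Cexp (f x))%C.
Proof.
intros [A B]; split.
- evar_last.
  { apply (is_derive_Rmult (fun t => exp (Re (f t))) (fun t => cos (Im (f t)))).
    - apply (is_derive_comp exp _ x _ _ (is_derive_exp _) A).
    - apply (is_derive_comp cos _ x _ _ (is_derive_cos _) B). }
  unfold scal; simpl; unfold mult, Re, Im; simpl; ring.
- evar_last.
  { apply (is_derive_Rmult (fun t => exp (Re (f t))) (fun t => sin (Im (f t)))).
    - apply (is_derive_comp exp _ x _ _ (is_derive_exp _) A).
    - apply (is_derive_comp sin _ x _ _ (is_derive_sin _) B). }
  unfold scal; simpl; unfold mult, Re, Im; simpl; ring.
Qed.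

Lemma Cexp_plus (a b : C) : Cexp (a + b) = (Cexp a * Cexp b)%C.
Proof.
unfold Cexp. destruct a as [a1 a2], b as [b1 b2].
apply injective_projections; simpl; rewrite exp_plus, ?cos_plus, ?sin_plus; ring.
Qed.

Lemma Cexp_0 : Cexp 0 = 1.
Proof. unfold Cexp; simpl. rewrite exp_0, cos_0, sin_0. unfold RtoC. f_equal; ring. Qed.

Lemma Cmod_Cexp (a : C) : Cmod (Cexp a) = exp (Re a).
Proof.
unfold Cmod, Cexp; simpl. pose proof (sin2_cos2 (Im a)) as H. unfold Rsqr in H.
replace (_ + _) with (exp (Re a) * exp (Re a)).
- apply sqrt_square. apply Rlt_le, exp_pos.
- unfold Re, Im in *. nra.
Qed.

Lemma Cexp_nz (a : C) : Cexp a <> 0.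
Proof. apply Cmod_gt_0. rewrite Cmod_Cexp. apply exp_pos. Qed.

Lemma Cexp_RtoC (r : R) : Cexp r = exp r.
Proof. unfold Cexp; simpl. rewrite cos_0, sin_0. unfold RtoC. f_equal; ring. Qed.

(* Componentwise mean value theorem: hence the factor 2. *)
Lemma cderiv_bound (f df : R -> C) (a b M : R) :
  a <= b -> (forall t, a <= t <= b -> is_cderiv f t (df t)) ->
  (forall t, a <= t <= b -> Cmod (df t) <= M) ->
  Cmod (f b - f a) <= 2 * M * (b - a).
Proof.
intros Hab Hd HM.
assert (Hr : forall (g dg : R -> R),
  (forall t, a <= t <= b -> is_derive g t (dg t)) ->
  (forall t, a <= t <= b -> Rabs (dg t) <= M) -> Rabs (g b - g a) <= M * (b - a)).
{ intros g dg Hg HMg.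
  destruct (MVT_gen g a b dg) as [c [Hc Ec]].
  - intros x Hx. rewrite Rmin_left, Rmax_right in Hx by lra. apply Hg; lra.
  - intros x Hx. rewrite Rmin_left, Rmax_right in Hx by lra.
    apply derivable_continuous_pt. exists (dg x). apply is_derive_Reals. apply Hg; lra.
  - rewrite Rmin_left, Rmax_right in Hc by lra.
    rewrite Ec, Rabs_mult, (Rabs_pos_eq (b - a)) by lra.
    apply Rmult_le_compat_r; [lra|]. apply HMg; lra. }
eapply Rle_trans; [apply Cmod_le_Re_Im|].
assert (H1 := Hr (fun t => Re (f t)) (fun t => Re (df t)) (fun t Ht => proj1 (Hd t Ht))
  (fun t Ht => Rle_trans _ _ _ (re_le_Cmod _) (HM t Ht))).
assert (H2 := Hr (fun t => Im (f t)) (fun t => Im (df t)) (fun t Ht => proj2 (Hd t Ht))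
  (fun t Ht => Rle_trans _ _ _ (Im_le_Cmod _) (HM t Ht))).
simpl in H1, H2. unfold Rminus in *.
change (Re (f b - f a)%C) with (Re (f b) + - Re (f a)).
change (Im (f b - f a)%C) with (Im (f b) + - Im (f a)). lra.
Qed.

Lemma is_derive_Cmod2 (f : R -> C) x l :
  is_cderiv f x l ->
  is_derive (fun t => Cmod (f t) ^ 2) x (2 * (Re (f x) * Re l + Im (f x) * Im l)).
Proof.
intros [A B].
apply is_derive_ext with (fun t => Re (f t) * Re (f t) + Im (f t) * Im (f t)).
{ intros t. apply (@eq_sym R). rewrite Cmod2_alt. ring. }
evar_last.
{ apply (is_derive_plus (fun t => Re (f t) * Re (f t)) (fun t => Im (f t) * Im (f t)));
    apply is_derive_Rmult; eassumption. }
unfold plus; simpl; ring.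
Qed.

Lemma Cauchy_Schwarz_C (a b : C) : Rabs (Re a * Re b + Im a * Im b) <= Cmod a * Cmod b.
Proof.
replace (Re a * Re b + Im a * Im b) with (Re (a * Cconj b)%C) by (unfold Re, Im; simpl; ring).
rewrite <- (Cmod_conj b), <- Cmod_mult. apply re_le_Cmod.
Qed.

(** The maximum is taken for the squared modulus, which is differentiable even at the zeros of
    [f]. *)
Lemma Cmod_attains_max (f df : R -> C) (a b : R) :
  a <= b -> (forall t, a <= t <= b -> is_cderiv f t (df t)) ->
  exists m, a <= m <= b /\ forall t, a <= t <= b -> Cmod (f t) <= Cmod (f m).
Proof.
intros Hab Hd.
destruct (continuity_ab_maj (fun t => Cmod (f t) ^ 2) a b Hab) as [m [Hm Hm']].
- intros c Hc. apply derivable_continuous_pt. eexists. apply is_derive_Reals.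
  apply is_derive_Cmod2, (Hd c Hc).
- exists m; split; [exact Hm'|]. intros t Ht. specialize (Hm t Ht).
  pose proof (Cmod_ge_0 (f t)); pose proof (Cmod_ge_0 (f m)).
  apply Rnot_lt_le; intros Hc. nra.
Qed.

(** * Uniform estimate for the hypergeometric equation *)

Lemma is_cderiv_Cinv (q : R -> C) x l :
  q x <> 0 -> is_cderiv q x l -> is_cderiv (fun t => / q t)%C x (- l / (q x * q x))%C.
Proof.
intros Hq [A B].
pose proof (proj1 (Cmod_gt_0 _) Hq) as H0. pose proof (Cmod2_alt (q x)) as H2.
assert (Hn : Re (q x) * Re (q x) + Im (q x) * Im (q x) <> 0) by nra.
split.
- apply is_derive_ext
    with (fun t => Re (q t) * / (Re (q t) * Re (q t) + Im (q t) * Im (q t))).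
  { intros t. unfold Re, Im; simpl. unfold Rdiv. now rewrite !Rmult_1_r. }
  evar_last.
  { apply is_derive_Rmult; [exact A|]. apply is_derive_inv; [|exact Hn].
    apply (is_derive_plus (fun t => Re (q t) * Re (q t)) (fun t => Im (q t) * Im (q t)));
    apply is_derive_Rmult; eassumption. }
  unfold plus; unfold Re, Im in *; simpl. field. split; [nra|exact Hn].
- apply is_derive_ext
    with (fun t => - Im (q t) * / (Re (q t) * Re (q t) + Im (q t) * Im (q t))).
  { intros t. unfold Re, Im; simpl. unfold Rdiv. now rewrite !Rmult_1_r. }
  evar_last.
  { apply is_derive_Rmult; [apply (is_derive_opp (fun t => Im (q t))); exact B|].
    apply is_derive_inv; [|exact Hn].
    apply (is_derive_plus (fun t => Re (q t) * Re (q t)) (fun t => Im (q t) * Im (q t)));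
    apply is_derive_Rmult; eassumption. }
  unfold plus, opp; unfold Re, Im in *; simpl. field. split; [nra|exact Hn].
Qed.

Lemma RtoC_nz (r : R) : r <> 0 -> RtoC r <> 0.
Proof. intros H E. apply H. now injection E. Qed.

Lemma Im_nz (c : C) : Im c <> 0 -> c <> 0.
Proof. intros H E. apply H. now rewrite E. Qed.

Section Key_base.

Variables (a b c : C) (F F1 F2 : R -> C) (W : R).
Let T := Rabs (Im c).
Let d := (a + b + 1)%C.
Let q (w : R) : C := (c + d * w)%C.
Let H (w : R) : C := (F1 w + a * b * (F w * / q w))%C.
Let E (w : R) : C := (a * b * (F1 w * / q w + F w * (- d / (q w * q w))))%C.

Hypothesis hc : 0 <= Re c.
Hypothesis hd : 0 <= Re d.
Hypothesis hT : 1 <= T.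
Hypothesis hW : 0 <= W.
Hypothesis hWd : W * (2 * Cmod d) <= T.
Hypothesis hF : forall w, 0 <= w <= W -> is_cderiv F w (F1 w).
Hypothesis hF1 : forall w, 0 <= w <= W -> is_cderiv F1 w (F2 w).
Hypothesis hode : forall w, 0 <= w <= W ->
  (w * (1 + w) * F2 w + q w * F1 w + a * b * F w)%C = 0.

(** [hWd] keeps the drift [w * Im d] of the imaginary part of [q] below half of [|Im c|]. *)
Lemma q_lower w : 0 <= w <= W -> T / 2 <= Cmod (q w).
Proof.
intros Hw. pose proof (Im_le_Cmod d) as Hd. pose proof (Rabs_pos (Im d)).
apply Rle_trans with (2 := Im_le_Cmod _).
replace (Im (q w)) with (Im c + Im d * w) by (unfold q, Im; simpl; ring).
pose proof (Rabs_triang_inv (Im c) (- (Im d * w))) as Ht.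
rewrite Rabs_Ropp, Rabs_mult, (Rabs_pos_eq w) in Ht by lra.
unfold Rminus in Ht; rewrite Ropp_involutive in Ht. fold T in Ht. nra.
Qed.

Lemma q_nz w : 0 <= w <= W -> q w <> 0.
Proof. intros Hw. apply Cmod_gt_0. pose proof (q_lower w Hw). lra. Qed.

(** [E] is the derivative of the correction [a * b * F / q] and is small because [q] is large. [F2]
    is left as it stands, since the equation turns it into [- q * H / (w * (1 + w))]. *)
Lemma is_cderiv_H w : 0 <= w <= W -> is_cderiv H w (F2 w + E w)%C.
Proof.
intros Hw. unfold H, E.
eapply is_cderiv_eq.
{ apply is_cderiv_plus; [now apply hF1|]. apply is_cderiv_scal.
  apply is_cderiv_mult; [now apply hF|].
  apply is_cderiv_Cinv; [now apply q_nz|].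
  unfold q. apply is_cderiv_plus; [apply is_cderiv_const|].
  apply is_cderiv_scal. apply is_cderiv_id. }
simpl. field. now apply q_nz.
Qed.

(** At the singular point [w = 0] the equation loses its leading term and reads [q * H = 0]. *)
Lemma H_0 : H 0 = 0.
Proof.
assert (H0 : 0 <= 0 <= W) by lra.
pose proof (hode 0 H0) as E0. pose proof (q_nz 0 H0) as Q0.
unfold H. replace (F1 0 + a * b * (F 0 * / q 0))%C
  with (/ q 0 * (0 * (1 + 0) * F2 0 + q 0 * F1 0 + a * b * F 0))%C.
- rewrite E0. ring.
- now field.
Qed.

(** Since [F2 = - q * H / (w * (1 + w))], the left side is [- Re q * |H|^2 / (w * (1 + w))]; the
    hypotheses [hc] and [hd] give [Re q >= 0]. *)
Lemma Re_H_F2 w : 0 < w <= W -> Re (H w) * Re (F2 w) + Im (H w) * Im (F2 w) <= 0.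
Proof.
intros Hw. assert (Hw' : 0 <= w <= W) by lra.
pose proof (q_nz w Hw') as Q0. pose proof (hode w Hw') as E0.
assert (Hp : 0 < w * (1 + w)) by nra.
assert (EF : (F2 w = RtoC (/ (w * (1 + w))) * (- (q w * H w)))%C).
{ rewrite RtoC_inv, RtoC_mult, RtoC_plus by lra.
  assert (RtoC w <> 0) by (apply RtoC_nz; lra).
  assert (RtoC 1 + RtoC w <> 0)%C by (rewrite <- RtoC_plus; apply RtoC_nz; lra).
  unfold H. replace (F2 w) with (/ (w * (1 + w)) * ((w * (1 + w) * F2 w + q w * F1 w + a * b * F w)
    - (q w * F1 w + a * b * F w)))%C by (field; auto).
  rewrite E0. field; auto. }
assert (Hq : 0 <= Re (q w)).
{ replace (Re (q w)) with (Re c + Re d * w) by (unfold q, Re; simpl; ring). nra. }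
rewrite EF.
replace (_ + _) with (- (/ (w * (1 + w)) * (Re (q w) * (Re (H w) * Re (H w) + Im (H w) * Im (H w)))))
  by (unfold Re, Im; simpl; ring).
apply Rinv_0_lt_compat in Hp.
assert (0 <= Re (q w) * (Re (H w) * Re (H w) + Im (H w) * Im (H w)))
  by (apply Rmult_le_pos; nra).
nra.
Qed.

(* In [(|H|^2)' = 2 Re (H^* H')] the homogeneous part of the equation for [H] contributes
   a nonpositive term, whatever the size of [Im c]. *)
Lemma H_bound e : (forall w, 0 <= w <= W -> Cmod (E w) <= e) ->
  forall w, 0 <= w <= W -> Cmod (H w) <= 2 * W * e.
Proof.
intros He w Hw.
destruct (Cmod_attains_max H _ 0 W hW is_cderiv_H) as [m [Hm Hmax]].
apply Rle_trans with (1 := Hmax w Hw).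
pose proof (Cmod_ge_0 (H m)) as S0.
assert (e0 : 0 <= e) by (eapply Rle_trans; [apply Cmod_ge_0|apply (He 0); lra]).
destruct (Rle_lt_or_eq_dec 0 m (proj1 Hm)) as [m0|<-].
2: { rewrite H_0, Cmod_0. nra. }
(* Working at the maximum point [m] closes the estimate: the mean value theorem on [[0, m]] gives
   [|H m|^2 <= 2 |H m| e W], and one factor [|H m|] cancels. *)
destruct (MVT_cor2 (fun t => Cmod (H t) ^ 2)
  (fun t => 2 * (Re (H t) * Re (F2 t + E t)%C + Im (H t) * Im (F2 t + E t)%C)) 0 m m0) as [x [Ex Hx]].
{ intros x Hx. apply is_derive_Reals. apply is_derive_Cmod2, is_cderiv_H. lra. }
cbv beta in Ex. rewrite H_0, Cmod_0 in Ex.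
pose proof (Re_H_F2 x ltac:(lra)) as Hneg.
pose proof (Cauchy_Schwarz_C (H x) (E x)) as HCS.
pose proof (Rle_abs (Re (H x) * Re (E x) + Im (H x) * Im (E x))) as Habs.
assert (Hx' : 0 <= x <= W) by lra.
assert (HHE : Cmod (H x) * Cmod (E x) <= Cmod (H m) * e).
{ apply Rmult_le_compat; try apply Cmod_ge_0; auto. }
change (Re (F2 x + E x)%C) with (Re (F2 x) + Re (E x)) in Ex.
change (Im (F2 x + E x)%C) with (Im (F2 x) + Im (E x)) in Ex.
assert (Hsq : Cmod (H m) * Cmod (H m) <= 2 * (Cmod (H m) * e) * m).
{ apply Rle_trans with (2 * (Re (H x) * (Re (F2 x) + Re (E x)) + Im (H x) * (Im (F2 x) + Im (E x))) * m).
  - lra.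
  - apply Rmult_le_compat_r; lra. }
assert (Hmul : (Cmod (H m) * e) * m <= (Cmod (H m) * e) * W)
  by (apply Rmult_le_compat_l; [now apply Rmult_le_pos|lra]).
apply Rnot_lt_le; intros Hc. assert (0 <= W * e) by nra. nra.
Qed.

(** A bootstrap on [M = max |F1|]: the bound [|F| <= |F 0| + 2 W M] controls [E], hence [H], hence
    [F1 = H - a b F / q] itself. When [W / T] is small the terms in [M] on the right are absorbed,
    leaving [M = O(|F 0| / T)]; integration over [[0, W]] yields the factor [W / T]. *)
Lemma key_base_jet :
  W * (1 + 2 * (8 * Cmod (a * b)%C + 16 * Cmod (a * b)%C * Cmod d)) <= T ->
  Cmod (F W - F 0) <= (32 * Cmod (a * b)%C * Cmod d + 8 * Cmod (a * b)%C) * (W / T) * Cmod (F 0).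
Proof.
intros HR.
set (A := Cmod (a * b)%C) in *. set (D := Cmod d) in *. set (m0 := Cmod (F 0)).
assert (A0 : 0 <= A) by apply Cmod_ge_0. assert (D0 : 0 <= D) by apply Cmod_ge_0.
assert (m00 : 0 <= m0) by apply Cmod_ge_0.
assert (T0 : 0 < T) by lra.
set (eps := W / T).
assert (eps0 : 0 <= eps) by (apply Rdiv_le_0_compat; lra).
assert (EW : W = eps * T) by (unfold eps; field; lra).
destruct (Cmod_attains_max F1 _ 0 W hW hF1) as [m [Hm Hmax]].
set (M := Cmod (F1 m)) in *.
assert (M0 : 0 <= M) by apply Cmod_ge_0.
assert (HFb : forall w, 0 <= w <= W -> Cmod (F w) <= m0 + 2 * W * M).
{ intros w Hw.
  assert (B : Cmod (F w - F 0) <= 2 * M * (w - 0)).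
  { apply cderiv_bound with F1; [lra| |]; intros t Ht; [apply hF|apply Hmax]; lra. }
  replace (F w) with ((F w - F 0) + F 0)%C by ring.
  pose proof (Cmod_triangle (F w - F 0) (F 0)). fold m0 in H0. nra. }
assert (Hqi : forall w, 0 <= w <= W -> Cmod (/ q w)%C <= 2 / T).
{ intros w Hw. pose proof (q_lower w Hw). rewrite Cmod_inv by now apply q_nz.
  replace (2 / T) with (/ (T / 2)) by (field; lra).
  apply Rinv_le_contravar; lra. }
set (Fb := m0 + 2 * W * M).
assert (Fb0 : 0 <= Fb) by (unfold Fb; nra).
assert (HT2 : 0 <= 2 / T) by (apply Rdiv_le_0_compat; lra).
set (e := A * (M * (2 / T) + Fb * (D * (2 / T * (2 / T))))).
assert (He : forall w, 0 <= w <= W -> Cmod (E w) <= e).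
{ intros w Hw. unfold E. rewrite Cmod_mult. fold A. apply Rmult_le_compat_l; [exact A0|].
  eapply Rle_trans; [apply Cmod_triangle|]. apply Rplus_le_compat.
  - rewrite Cmod_mult. apply Rmult_le_compat; try apply Cmod_ge_0; [now apply Hmax|auto].
  - rewrite Cmod_mult. apply Rmult_le_compat; try apply Cmod_ge_0; [now apply HFb|].
    replace (- d / (q w * q w))%C with (- d * (/ q w * / q w))%C by (field; now apply q_nz).
    rewrite !Cmod_mult, Cmod_opp. fold D. apply Rmult_le_compat_l; [exact D0|].
    apply Rmult_le_compat; try apply Cmod_ge_0; auto. }
assert (HM : M <= 2 * W * e + A * (Fb * (2 / T))).
{ unfold M. replace (F1 m) with (H m - a * b * (F m * / q m))%C by (unfold H; ring).
  eapply Rle_trans; [apply Cmod_triangle|]. rewrite Cmod_opp. apply Rplus_le_compat.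
  - now apply H_bound.
  - rewrite !(Cmod_mult (a * b)). fold A. apply Rmult_le_compat_l; [exact A0|].
    rewrite Cmod_mult. apply Rmult_le_compat; try apply Cmod_ge_0; auto. }
assert (He' : 2 * W * e + A * (Fb * (2 / T)) =
  eps * M * (8 * A + 16 * A * D * eps) + m0 / T * (8 * A * D * eps + 2 * A)).
{ unfold e, Fb. rewrite EW. field. lra. }
rewrite He' in HM.
(* The summand 1 gives [eps <= 1]; the other one makes the coefficient of [M] at most 1/2, so that
   it can be absorbed. *)
assert (eps1 : eps * (1 + 2 * (8 * A + 16 * A * D)) <= 1).
{ apply Rmult_le_reg_r with T; [exact T0|]. rewrite EW in HR. lra. }
assert (AD : 0 <= A * D) by nra.
assert (eps2 : eps <= 1) by nra.
assert (m0T : 0 <= m0 / T) by (apply Rdiv_le_0_compat; lra).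
assert (U1 : eps * M * (8 * A + 16 * A * D * eps) <= M / 2).
{ replace (eps * M * (8 * A + 16 * A * D * eps)) with (M * (eps * (8 * A + 16 * A * D * eps))) by ring.
  apply Rmult_le_compat_l with (r := M) (r2 := / 2); [exact M0|].
  assert (A * D * eps <= A * D * 1) by (apply Rmult_le_compat_l; lra).
  assert (eps * (8 * A + 16 * A * D * eps) <= eps * (8 * A + 16 * A * D))
    by (apply Rmult_le_compat_l; lra).
  lra. }
assert (U2 : m0 / T * (8 * A * D * eps + 2 * A) <= m0 / T * (8 * A * D + 2 * A)).
{ apply Rmult_le_compat_l; [exact m0T|]. nra. }
assert (HM2 : M <= 2 * (m0 / T * (8 * A * D + 2 * A))) by lra.
assert (B : Cmod (F W - F 0) <= 2 * M * (W - 0)).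
{ apply cderiv_bound with F1; [lra| |]; intros t Ht; [apply hF|apply Hmax]; lra. }
eapply Rle_trans; [exact B|].
apply Rle_trans with (2 * (2 * (m0 / T * (8 * A * D + 2 * A))) * (W - 0)).
- apply Rmult_le_compat_r; lra.
- apply Req_le. unfold eps. field. lra.
Qed.

End Key_base.

(** * Successive derivatives of a solution, and removal of the sign conditions *)

(** The [n]-th derivative of a solution solves the equation with [a], [b], [c] raised by [n].
    Carrying all derivatives at once makes the class stable under differentiation. *)
Definition hyp_jet (a b c : C) (W : R) (G : nat -> R -> C) : Prop :=
  (forall n w, 0 <= w <= W -> is_cderiv (G n) w (G (S n) w)) /\
  (forall n w, 0 <= w <= W ->
    w * (1 + w) * G (S (S n)) w
    + ((c + INR n) + (a + INR n + (b + INR n) + 1) * w) * G (S n) w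
    + (a + INR n) * (b + INR n) * G n w = 0)%C.

Lemma hyp_jet_shift a b c W G :
  hyp_jet a b c W G -> hyp_jet (a + 1) (b + 1) (c + 1) W (fun n => G (S n)).
Proof.
intros [H1 H2]; split; [intros n; apply H1|].
intros n w Hw. rewrite <- (H2 (S n) w Hw). rewrite S_INR, RtoC_plus. ring.
Qed.

Lemma hyp_jet_minus a b c W G1 G2 :
  hyp_jet a b c W G1 -> hyp_jet a b c W G2 ->
  hyp_jet a b c W (fun n w => G1 n w - G2 n w)%C.
Proof.
intros [H1 H2] [K1 K2]; split.
- intros n w Hw. apply is_cderiv_minus; auto.
- intros n w Hw. replace (RtoC 0) with (RtoC 0 - RtoC 0)%C by ring.
  rewrite <- (H2 n w Hw) at 1. rewrite <- (K2 n w Hw). ring.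
Qed.

(* Differentiation shifts [a], [b], [c] by 1, so finitely many shifts reach the range
   [0 <= Re c], [0 <= Re (a + b + 1)] of [key_base_jet]; integrating back only uses the
   crude bound on the derivative. *)
Lemma hyp_jet_bound (m : nat) : forall (a b : C) (cr : R),
  0 <= cr + INR m -> 0 <= Re (a + b + 1)%C + 2 * INR m ->
  exists K R0, 0 <= K /\ 1 <= R0 /\ forall c W G,
    Re c = cr -> 1 <= Rabs (Im c) -> 0 <= W -> W * R0 <= Rabs (Im c) ->
    hyp_jet a b c W G ->
    Cmod (G 0%nat W - G 0%nat 0) <= K * (W / Rabs (Im c)) * Cmod (G 0%nat 0).
Proof.
induction m as [|m IH]; intros a b cr Hc Hd.
- set (A := Cmod (a * b)%C). set (D := Cmod (a + b + 1)%C).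
  assert (A0 : 0 <= A) by apply Cmod_ge_0. assert (D0 : 0 <= D) by apply Cmod_ge_0.
  assert (AD : 0 <= A * D) by nra.
  (* The second witness adds up the two smallness conditions of [key_base_jet]. *)
  exists (32 * A * D + 8 * A), (1 + 2 * D + 2 * (8 * A + 16 * A * D)).
  split; [nra|split; [nra|]].
  intros c W G Ec HT HW HR [H1 H2]. change (INR 0) with 0 in Hc, Hd.
  apply key_base_jet with (F1 := G 1%nat) (F2 := G 2%nat); try fold A; try fold D; auto.
  + lra.
  + lra.
  + apply Rle_trans with (2 := HR). apply Rmult_le_compat_l; lra.
  + intros w Hw. rewrite <- (H2 0%nat w Hw). simpl. ring.
  + apply Rle_trans with (2 := HR). apply Rmult_le_compat_l; lra.
- destruct (IH (a + 1)%C (b + 1)%C (cr + 1)) as [K [R0 [HK [HR0 HB]]]].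
  + rewrite S_INR in Hc. lra.
  + rewrite S_INR in Hd. unfold Re in *; simpl in *. lra.
  + set (A := Cmod (a * b)%C). assert (A0 : 0 <= A) by apply Cmod_ge_0.
    exists (2 * ((1 + K) * A)), R0.
    split; [nra|split; [exact HR0|]].
    intros c W G Ec HT HW HR HG.
    assert (T0 : 0 < Rabs (Im c)) by lra.
    assert (EIm : Im (c + 1)%C = Im c) by (unfold Im; simpl; ring).
    assert (c0 : c <> 0) by (apply Im_nz; intros E; rewrite E, Rabs_R0 in T0; lra).
    (* The equation at the singular point fixes the derivative there; its division by [c] is the
       source of the gain [1 / |Im c|]. *)
    assert (E1 : G 1%nat 0 = (- (a * b / c) * G 0%nat 0)%C).
    { destruct HG as [_ H2]. pose proof (H2 0%nat 0 ltac:(lra)) as E.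
      simpl in E.
      replace (G 1%nat 0) with (/ c * (0 * (1 + 0) * G 2%nat 0
        + (c + 0 + (a + 0 + (b + 0) + 1) * 0) * G 1%nat 0
        + (a + 0) * (b + 0) * G 0%nat 0) - a * b / c * G 0%nat 0)%C by (field; exact c0).
      rewrite E. ring. }
    assert (HcT : Rabs (Im c) <= Cmod c) by apply Im_le_Cmod.
    set (g0 := Cmod (G 0%nat 0)). assert (g00 : 0 <= g0) by apply Cmod_ge_0.
    assert (B1 : Cmod (G 1%nat 0) <= A / Rabs (Im c) * g0).
    { rewrite E1, Cmod_mult, Cmod_opp, Cmod_div by exact c0. fold A g0.
      apply Rmult_le_compat_r; [exact g00|]. unfold Rdiv. apply Rmult_le_compat_l; [exact A0|].
      now apply Rinv_le_contravar. }
    assert (B2 : forall w, 0 <= w <= W -> Cmod (G 1%nat w) <= (1 + K) * (A / Rabs (Im c) * g0)).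
    { intros w Hw.
      assert (HB' := HB (c + 1)%C w (fun n => G (S n))).
      rewrite EIm in HB'.
      assert (HwR : w * R0 <= Rabs (Im c)).
      { apply Rle_trans with (2 := HR). apply Rmult_le_compat_r; lra. }
      specialize (HB' ltac:(unfold Re in *; simpl; lra) HT (proj1 Hw) HwR).
      assert (HJ : hyp_jet (a + 1) (b + 1) (c + 1) w (fun n => G (S n))).
      { destruct (hyp_jet_shift _ _ _ _ _ HG) as [J1 J2].
        split; intros n t Ht; [apply J1|apply J2]; lra. }
      specialize (HB' HJ). simpl in HB'.
      assert (Hw1 : w / Rabs (Im c) <= 1) by (apply Rle_div_l; [lra|nra]).
      assert (Hw0 : 0 <= w / Rabs (Im c)) by (apply Rdiv_le_0_compat; lra).
      pose proof (Cmod_ge_0 (G 1%nat 0)) as g1.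
      assert (HK1 : K * (w / Rabs (Im c)) * Cmod (G 1%nat 0) <= K * Cmod (G 1%nat 0)).
      { apply Rmult_le_compat_r; [exact g1|]. rewrite <- (Rmult_1_r K) at 2.
        apply Rmult_le_compat_l; lra. }
      replace (G 1%nat w) with ((G 1%nat w - G 1%nat 0) + G 1%nat 0)%C by ring.
      eapply Rle_trans; [apply Cmod_triangle|].
      apply Rle_trans with ((1 + K) * Cmod (G 1%nat 0)); [lra|].
      apply Rmult_le_compat_l; lra. }
    apply Rle_trans with (2 * ((1 + K) * (A / Rabs (Im c) * g0)) * (W - 0)).
    * apply cderiv_bound with (G 1%nat); auto. intros t Ht. now apply (proj1 HG).
    * apply Req_le. unfold g0. field. lra.
Qed.

(** * Hypergeometric series of a real argument *)

Definition CPS (u : nat -> C) (x : R) : C :=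
  (PSeries (fun n => Re (u n)) x, PSeries (fun n => Im (u n)) x).

Definition is_CPS (u : nat -> C) (x : R) (l : C) : Prop :=
  is_pseries (fun n => Re (u n)) x (Re l) /\ is_pseries (fun n => Im (u n)) x (Im l).

Definition unit_radius (u : nat -> C) : Prop :=
  forall r, 0 <= r < 1 -> exists M, forall n, Cmod (u n) * r ^ n <= M.

(** With the coefficient sequences of the derivative and of the product by the variable, a
    differential equation becomes an identity between coefficients. *)
Definition cder (u : nat -> C) (n : nat) : C := (INR (S n) * u (S n))%C.
Definition cshift (u : nat -> C) (n : nat) : C :=
  match n with O => 0 | S m => u m end.

Lemma is_CPS_unique u x l l' : is_CPS u x l -> is_CPS u x l' -> l = l'.
Proof.
intros [A B] [A' B']. apply C_eq.
- now rewrite <- (is_pseries_unique _ _ _ A), <- (is_pseries_unique _ _ _ A').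
- now rewrite <- (is_pseries_unique _ _ _ B), <- (is_pseries_unique _ _ _ B').
Qed.

Lemma is_CPS_ext u v x l : (forall n, u n = v n) -> is_CPS u x l -> is_CPS v x l.
Proof.
intros H [A B]; split.
- apply is_pseries_ext with (2 := A). intros n; now rewrite H.
- apply is_pseries_ext with (2 := B). intros n; now rewrite H.
Qed.

Lemma CPS_ext u v x : (forall n, u n = v n) -> CPS u x = CPS v x.
Proof. intros H. unfold CPS. f_equal; apply PSeries_ext; intros n; now rewrite H. Qed.

Lemma is_CPS_plus u v x l m :
  is_CPS u x l -> is_CPS v x m -> is_CPS (fun n => u n + v n)%C x (l + m)%C.
Proof. intros [A B] [A' B']; split; now apply @is_pseries_plus. Qed.

Lemma is_CPS_scal k u x l : is_CPS u x l -> is_CPS (fun n => k * u n)%C x (k * l)%C.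
Proof.
assert (HS : forall (k : R) a l, is_pseries a x l -> is_pseries (fun n => k * a n) x (k * l)).
{ intros r a m H. apply (is_pseries_scal r a x m); [apply Rmult_comm|exact H]. }
intros [A B]; split.
- apply (is_pseries_minus (fun n => Re k * Re (u n)) (fun n => Im k * Im (u n)) x
    (Re k * Re l) (Im k * Im l)); now apply HS.
- apply (is_pseries_plus (fun n => Re k * Im (u n)) (fun n => Im k * Re (u n)) x
    (Re k * Im l) (Im k * Re l)); now apply HS.
Qed.

Lemma is_CPS_shift u (x : R) l : is_CPS u x l -> is_CPS (cshift u) x (x * l)%C.
Proof.
intros [A B]; split.
- replace (Re (x * l)%C) with (x * Re l) by (unfold Re, Im; simpl; ring).
  apply is_pseries_ext with (2 := is_pseries_incr_1 _ _ _ A). now intros [|n].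
- replace (Im (x * l)%C) with (x * Im l) by (unfold Re, Im; simpl; ring).
  apply is_pseries_ext with (2 := is_pseries_incr_1 _ _ _ B). now intros [|n].
Qed.

Lemma is_CPS_zero x l : is_CPS (fun _ => 0) x l -> l = 0.
Proof.
intros H. assert (Z := is_CPS_scal 0 _ _ _ H).
rewrite Cmult_0_l in Z. apply is_CPS_unique with (1 := H).
apply is_CPS_ext with (2 := Z). intros _. apply Cmult_0_l.
Qed.

Lemma unit_radius_CV u x : unit_radius u -> Rabs x < 1 ->
  Rbar_lt (Rabs x) (CV_radius (fun n => Re (u n))) /\
  Rbar_lt (Rabs x) (CV_radius (fun n => Im (u n))).
Proof.
intros Hu Hx. pose proof (Rabs_pos x) as Hx0.
set (r := (Rabs x + 1) / 2).
assert (Hr : 0 <= r < 1) by (unfold r; lra).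
destruct (Hu r Hr) as [M HM].
assert (Hrn : forall n, 0 <= r ^ n) by (intros n; apply pow_le; lra).
assert (G : forall a, (forall n, Rabs (a n) <= Cmod (u n)) -> Rbar_lt (Rabs x) (CV_radius a)).
{ intros a Ha. apply Rbar_lt_le_trans with (Finite r); [simpl; unfold r; lra|].
  apply (proj1 (CV_radius_bounded a)). exists M. intros n.
  apply Rle_trans with (2 := HM n). rewrite Rabs_mult, (Rabs_pos_eq (r ^ n)) by auto.
  now apply Rmult_le_compat_r. }
split; apply G; intros n; [apply re_le_Cmod|apply Im_le_Cmod].
Qed.

Lemma CPS_correct u x : unit_radius u -> Rabs x < 1 -> is_CPS u x (CPS u x).
Proof.
intros Hu Hx. destruct (unit_radius_CV u x Hu Hx) as [A B].
split; apply PSeries_correct, CV_radius_inside; assumption.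
Qed.

Lemma is_cderiv_CPS u x : unit_radius u -> Rabs x < 1 ->
  is_cderiv (CPS u) x (CPS (cder u) x).
Proof.
intros Hu Hx. destruct (unit_radius_CV u x Hu Hx) as [A B]. split.
- replace (Re (CPS (cder u) x)) with (PSeries (PS_derive (fun n => Re (u n))) x).
  + apply (is_derive_PSeries (fun n => Re (u n))), A.
  + apply PSeries_ext. intros n. unfold PS_derive, cder, Re, Cmult, RtoC. cbn [fst snd]. ring.
- replace (Im (CPS (cder u) x)) with (PSeries (PS_derive (fun n => Im (u n))) x).
  + apply (is_derive_PSeries (fun n => Im (u n))), B.
  + apply PSeries_ext. intros n. unfold PS_derive, cder, Im, Cmult, RtoC. cbn [fst snd]. ring.
Qed.

Lemma CPS_0 u : CPS u 0 = u 0%nat.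
Proof. unfold CPS. rewrite !PSeries_0. symmetry. apply surjective_pairing. Qed.

Lemma cshift_cder u n : cshift (cder u) n = (INR n * u n)%C.
Proof. destruct n; [simpl; ring|reflexivity]. Qed.

(** * Hypergeometric coefficients: recurrence, equation, contiguous relation *)

Definition hcoef (a b c : C) (n : nat) : C :=
  (poch a n * poch b n / (poch c n * INR (fact n)))%C.

Lemma hyp2F1_RtoC a b c (x : R) : hyp2F1 a b c x = CPS (hcoef a b c) x.
Proof.
unfold hyp2F1, CSeries, CPS, PSeries.
assert (E : forall n, (poch a n * poch b n / (poch c n * INR (fact n)) * RtoC x ^ n)%C
  = (RtoC (x ^ n) * hcoef a b c n)%C).
{ intros n. rewrite <- RtoC_pow. unfold hcoef. ring. }
f_equal; apply Series_ext; intros n; rewrite E.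
- rewrite Re_mult. simpl. ring.
- rewrite Im_mult. simpl. ring.
Qed.

Lemma hyp2F1_sym a b c x : hyp2F1 a b c x = hyp2F1 b a c x.
Proof.
unfold hyp2F1, CSeries.
f_equal; apply Series_ext; intros n; now rewrite (Cmult_comm (poch a n)).
Qed.

Lemma poch_left a n : poch a (S n) = (a * poch (a + 1) n)%C.
Proof.
induction n as [|n IH]; [simpl; ring|].
change (poch a (S (S n))) with (poch a (S n) * (a + INR (S n)))%C.
rewrite IH. change (poch (a + 1) (S n)) with (poch (a + 1) n * (a + 1 + INR n))%C.
rewrite S_INR, RtoC_plus. ring.
Qed.

Lemma Im_plus_INR c n : Im (c + INR n)%C = Im c.
Proof. unfold Im; simpl; ring. Qed.

Lemma plus_INR_nz c n : Im c <> 0 -> (c + INR n)%C <> 0.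
Proof. intros H. apply Im_nz. now rewrite Im_plus_INR. Qed.

Lemma poch_nz c n : Im c <> 0 -> poch c n <> 0.
Proof.
intros H. induction n as [|n IH]; simpl.
- apply RtoC_nz. lra.
- apply Cmult_neq_0; [exact IH|now apply plus_INR_nz].
Qed.

Lemma INR_S_nz n : RtoC (INR (S n)) <> 0.
Proof. apply RtoC_nz. apply not_0_INR. lia. Qed.

Lemma fact_nz n : RtoC (INR (fact n)) <> 0.
Proof. apply RtoC_nz, INR_fact_neq_0. Qed.

Lemma fact_S_C n : RtoC (INR (fact (S n))) = (INR (S n) * INR (fact n))%C.
Proof. rewrite <- RtoC_mult, <- mult_INR. reflexivity. Qed.

Lemma hcoef_0 a b c : hcoef a b c 0 = 1.
Proof. unfold hcoef; simpl. field. Qed.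

Lemma hcoef_S a b c n : Im c <> 0 ->
  hcoef a b c (S n) = ((a + INR n) * (b + INR n) / ((c + INR n) * INR (S n)) * hcoef a b c n)%C.
Proof.
intros Hc. unfold hcoef. rewrite fact_S_C. cbn [poch].
pose proof (poch_nz c n Hc). pose proof (plus_INR_nz c n Hc).
pose proof (INR_S_nz n). pose proof (fact_nz n). field; auto.
Qed.

Lemma nonincr_bounded (v : nat -> R) (N : nat) :
  (forall n, (N <= n)%nat -> v (S n) <= v n) -> exists M, forall n, v n <= M.
Proof.
intros H.
assert (exists M, forall n, (n <= N)%nat -> v n <= M) as [M HM].
{ clear H. induction N as [|N [M HM]].
  - exists (v O). intros n Hn. replace n with O by lia. lra.
  - exists (Rmax M (v (S N))). intros n Hn.
    destruct (Nat.eq_dec n (S N)) as [->|]; [apply Rmax_r|].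
    apply Rle_trans with (2 := Rmax_l _ _). apply HM. lia. }
exists M. intros n. destruct (Nat.le_gt_cases n N) as [Hn|Hn]; [now apply HM|].
induction n as [|n IH]; [lia|].
destruct (Nat.eq_dec n N) as [->|].
- apply Rle_trans with (v N); [apply H; lia|apply HM; lia].
- apply Rle_trans with (v n); [apply H; lia|apply IH; lia].
Qed.

(** The ratio of consecutive coefficients tends to 1 in modulus, so after multiplication by [r < 1]
    it is eventually at most 1 and [|u n| * r^n] is eventually nonincreasing. *)
Lemma hcoef_radius a b c : Im c <> 0 -> unit_radius (hcoef a b c).
Proof.
intros Hc r Hr.
set (A := Cmod a). set (B := Cmod b). set (D := Cmod c).
assert (A0 : 0 <= A) by apply Cmod_ge_0. assert (B0 : 0 <= B) by apply Cmod_ge_0.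
assert (D0 : 0 <= D) by apply Cmod_ge_0.
(* Beyond this threshold [x^2 * (1 - r)] dominates the lower-order terms in
   [(A + x) (B + x) r <= (x - D) (x + 1)]. *)
destruct (nfloor_ex ((A + B + D + A * B + D + D) / (1 - r))) as [N [HN1 HN2]].
{ apply Rdiv_le_0_compat; [nra|lra]. }
apply nonincr_bounded with (S N). intros n Hn.
apply le_INR in Hn. rewrite S_INR in Hn.
set (x := INR n) in *.
assert (Hx1 : 1 <= x) by (pose proof (pos_INR N); unfold x in *; lra).
assert (Hx : A + B + D + A * B + D + D <= x * (1 - r)).
{ apply Rle_div_l; lra. }
rewrite hcoef_S by exact Hc. rewrite Cmod_mult. simpl pow.
set (h := Cmod (hcoef a b c n)). assert (h0 : 0 <= h) by apply Cmod_ge_0.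
assert (rn : 0 <= r ^ n) by (apply pow_le; lra).
set (p := r ^ n) in *.
assert (Hq : Cmod ((a + INR n) * (b + INR n) / ((c + INR n) * INR (S n))) * r <= 1).
{ rewrite Cmod_div by (apply Cmult_neq_0; [now apply plus_INR_nz|apply INR_S_nz]).
  rewrite !Cmod_mult.
  assert (EN : forall m, Cmod (INR m) = INR m)
    by (intros m; rewrite Cmod_R; apply Rabs_pos_eq, pos_INR).
  rewrite EN, S_INR. fold x.
  assert (HA : Cmod (a + x) <= A + x).
  { eapply Rle_trans; [apply Cmod_triangle|]. unfold x at 1. rewrite EN. fold A x. lra. }
  assert (HB : Cmod (b + x) <= B + x).
  { eapply Rle_trans; [apply Cmod_triangle|]. unfold x at 1. rewrite EN. fold B x. lra. }
  assert (HD : x - D <= Cmod (c + x)).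
  { pose proof (Cmod_triangle (c + x) (- c)) as Ht. rewrite Cmod_opp in Ht. fold D in Ht.
    replace (c + x + - c)%C with (RtoC x) in Ht by ring. unfold x in Ht at 1.
    rewrite EN in Ht. fold x in Ht. lra. }
  pose proof (Cmod_ge_0 (a + x)). pose proof (Cmod_ge_0 (b + x)).
  assert (HDx : 0 < x - D) by nra.
  unfold Rdiv. rewrite Rmult_assoc, (Rmult_comm (/ _)), <- Rmult_assoc.
  apply Rle_div_l; [apply Rmult_lt_0_compat; lra|]. rewrite Rmult_1_l.
  apply Rle_trans with ((A + x) * (B + x) * r).
  { apply Rmult_le_compat_r; [lra|]. apply Rmult_le_compat; auto. }
  apply Rle_trans with ((x - D) * (x + 1)).
  2: apply Rmult_le_compat_r; lra.
  assert (x * (A + B + D + A * B + D + D) <= x * (x * (1 - r)))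
    by (apply Rmult_le_compat_l; lra).
  assert (A * B * r <= A * B * 1) by (apply Rmult_le_compat_l; [nra|lra]).
  assert ((A + B) * x * r <= (A + B) * x * 1) by (apply Rmult_le_compat_l; [nra|lra]).
  assert (0 <= A * B) by nra.
  assert (A * B * 1 <= A * B * x) by (apply Rmult_le_compat_l; lra).
  assert (D * 1 <= D * x) by (apply Rmult_le_compat_l; lra).
  nra. }
replace (Cmod _ * h * (r * p)) with (Cmod ((a + INR n) * (b + INR n) / ((c + INR n) * INR (S n))) * r * (h * p)) by ring.
rewrite <- (Rmult_1_l (h * p)) at 2. apply Rmult_le_compat_r; [nra|exact Hq].
Qed.

Lemma cder_hcoef a b c n : Im c <> 0 ->
  cder (hcoef a b c) n = (a * b / c * hcoef (a + 1) (b + 1) (c + 1) n)%C.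
Proof.
intros Hc. unfold cder, hcoef. rewrite fact_S_C, !poch_left.
assert (Hc1 : Im (c + 1)%C <> 0) by (unfold Im in *; simpl; lra).
pose proof (poch_nz _ n Hc1). pose proof (Im_nz _ Hc).
pose proof (INR_S_nz n). pose proof (fact_nz n). field; auto.
Qed.

Lemma unit_radius_scal k u : unit_radius u -> unit_radius (fun n => k * u n)%C.
Proof.
intros Hu r Hr. destruct (Hu r Hr) as [M HM]. exists (Cmod k * M). intros n.
rewrite Cmod_mult, Rmult_assoc. apply Rmult_le_compat_l; [apply Cmod_ge_0|auto].
Qed.

Lemma CPS_scal k u x : unit_radius u -> Rabs x < 1 ->
  CPS (fun n => k * u n)%C x = (k * CPS u x)%C.
Proof.
intros Hu Hx. apply is_CPS_unique with (fun n => k * u n)%C x.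
- apply CPS_correct; [now apply unit_radius_scal|exact Hx].
- apply is_CPS_scal. now apply CPS_correct.
Qed.

Lemma is_cderiv_hyp a b c x : Im c <> 0 -> Rabs x < 1 ->
  is_cderiv (CPS (hcoef a b c)) x (a * b / c * CPS (hcoef (a + 1) (b + 1) (c + 1)) x)%C.
Proof.
intros Hc Hx. assert (Hc1 : Im (c + 1)%C <> 0) by (unfold Im in *; simpl; lra).
eapply is_cderiv_eq; [apply is_cderiv_CPS; [now apply hcoef_radius|exact Hx]|].
rewrite <- CPS_scal by (auto using hcoef_radius).
apply CPS_ext. intros n. now apply cder_hcoef.
Qed.

(** Gauss's equation with the derivatives written as series with raised parameters, the form in
    which it can be iterated. *)
Lemma hyp_ode a b c (x : R) : Im c <> 0 -> Rabs x < 1 ->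
  (x * (1 - x) * (a * b / c * ((a + 1) * (b + 1) / (c + 1))
                  * CPS (hcoef (a + 1 + 1) (b + 1 + 1) (c + 1 + 1)) x)
   + (c - (a + b + 1) * x) * (a * b / c * CPS (hcoef (a + 1) (b + 1) (c + 1)) x)
   - a * b * CPS (hcoef a b c) x)%C = 0.
Proof.
intros Hc Hx.
assert (Hc1 : Im (c + 1)%C <> 0) by (unfold Im in *; simpl; lra).
assert (Hc2 : Im (c + 1 + 1)%C <> 0) by (unfold Im in *; simpl; lra).
set (f := CPS (hcoef a b c) x). set (k1 := (a * b / c)%C).
set (k2 := ((a + 1) * (b + 1) / (c + 1))%C).
set (f1 := CPS (hcoef (a + 1) (b + 1) (c + 1)) x).
set (f2 := CPS (hcoef (a + 1 + 1) (b + 1 + 1) (c + 1 + 1)) x).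
set (h := hcoef a b c).
assert (S0 : is_CPS h x f) by (apply CPS_correct; [now apply hcoef_radius|exact Hx]).
assert (S1 : is_CPS (cder h) x (k1 * f1)%C).
{ apply is_CPS_ext with (fun n => k1 * hcoef (a + 1) (b + 1) (c + 1) n)%C.
  - intros n. symmetry. now apply cder_hcoef.
  - apply is_CPS_scal, CPS_correct; [now apply hcoef_radius|exact Hx]. }
assert (S2 : is_CPS (cder (cder h)) x (k1 * k2 * f2)%C).
{ apply is_CPS_ext with (fun n => (k1 * k2) * hcoef (a + 1 + 1) (b + 1 + 1) (c + 1 + 1) n)%C.
  - intros n. symmetry. unfold cder at 1. unfold h. rewrite cder_hcoef by exact Hc.
    fold k1. transitivity (k1 * cder (hcoef (a + 1) (b + 1) (c + 1)) n)%C; [unfold cder; ring|].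
    rewrite cder_hcoef by exact Hc1. unfold k2. ring.
  - apply is_CPS_scal, CPS_correct; [now apply hcoef_radius|exact Hx]. }
apply is_CPS_zero with x.
apply is_CPS_ext with (fun n =>
  cshift (cder (cder h)) n + (-(1) * cshift (cshift (cder (cder h))) n +
   (c * cder h n + (- (a + b + 1) * cshift (cder h) n + - (a * b) * h n))))%C.
(* By the recurrence, and since shifting a derivative multiplies [h n] by [n], every term is a
   multiple of the single coefficient [h n]. *)
- assert (R : forall n, cder h n = ((a + INR n) * (b + INR n) / (c + INR n) * h n)%C).
  { intros n. unfold cder, h. rewrite hcoef_S by exact Hc.
    pose proof (plus_INR_nz c n Hc). pose proof (INR_S_nz n). field; auto. }
  intros n. rewrite !cshift_cder.
  replace (cshift (cshift (cder (cder h))) n) with (INR n * (INR n - 1) * h n)%C.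
  + rewrite R. pose proof (plus_INR_nz c n Hc). field; auto.
  + destruct n as [|m]; [simpl; ring|]. cbn [cshift]. rewrite cshift_cder.
    unfold cder. rewrite S_INR, RtoC_plus. ring.
- replace (_ - _)%C with (x * (k1 * k2 * f2) + (-(1) * (x * (x * (k1 * k2 * f2))) +
   (c * (k1 * f1) + (- (a + b + 1) * (x * (k1 * f1)) + - (a * b) * f))))%C by ring.
  exact (is_CPS_plus _ _ _ _ _ (is_CPS_shift _ _ _ S2) 
    (is_CPS_plus _ _ _ _ _ (is_CPS_scal _ _ _ _ (is_CPS_shift _ _ _ (is_CPS_shift _ _ _ S2))) 
    (is_CPS_plus _ _ _ _ _ (is_CPS_scal _ _ _ _ S1) 
    (is_CPS_plus _ _ _ _ _ (is_CPS_scal _ _ _ _ (is_CPS_shift _ _ _ S1)) (is_CPS_scal _ _ _ _ S0))))).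
Qed.

(** From [a (a+1)_n = (a)_n (a + n)], and the same for [c]. The factor [a] stays on the left because
    [a] may be 0. *)
Lemma hcoef_shift_ac a b c n : Im c <> 0 ->
  (a * hcoef (a + 1) b (c + 1) n = c * (a + INR n) / (c + INR n) * hcoef a b c n)%C.
Proof.
intros Hc. assert (Hc1 : Im (c + 1)%C <> 0) by (unfold Im in *; simpl; lra).
pose proof (poch_left a n) as Ea. pose proof (poch_left c n) as Ec. cbn [poch] in Ea, Ec.
pose proof (poch_nz _ n Hc1). pose proof (poch_nz _ n Hc). pose proof (Im_nz _ Hc).
pose proof (fact_nz n). pose proof (plus_INR_nz c n Hc).
unfold hcoef.
replace (a * (poch (a + 1) n * poch b n / (poch (c + 1) n * INR (fact n))))%C
  with (c * (a * poch (a + 1) n) * poch b n / ((c * poch (c + 1) n) * INR (fact n)))%C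
  by (field; auto).
rewrite <- Ea, <- Ec. field; auto.
Qed.

(** This relation makes the derivative of a Pfaff form again a Pfaff form, with all three parameters
    raised; [b] here plays the role of [c - b] there, which the raising leaves unchanged. *)
Lemma hyp_contiguous a b c (x : R) : Im c <> 0 -> Rabs x < 1 ->
  ((1 - x) * (a * b / c * CPS (hcoef (a + 1) (b + 1) (c + 1)) x) - a * CPS (hcoef a b c) x
   = - (a * (c - b) / c) * CPS (hcoef (a + 1) b (c + 1)) x)%C.
Proof.
intros Hc Hx.
assert (Hc1 : Im (c + 1)%C <> 0) by (unfold Im in *; simpl; lra).
set (f := CPS (hcoef a b c) x). set (k1 := (a * b / c)%C).
set (f1 := CPS (hcoef (a + 1) (b + 1) (c + 1)) x).
set (g := CPS (hcoef (a + 1) b (c + 1)) x).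
set (h := hcoef a b c).
assert (S0 : is_CPS h x f) by (apply CPS_correct; [now apply hcoef_radius|exact Hx]).
assert (S1 : is_CPS (cder h) x (k1 * f1)%C).
{ apply is_CPS_ext with (fun n => k1 * hcoef (a + 1) (b + 1) (c + 1) n)%C.
  - intros n. symmetry. now apply cder_hcoef.
  - apply is_CPS_scal, CPS_correct; [now apply hcoef_radius|exact Hx]. }
assert (SG : is_CPS (hcoef (a + 1) b (c + 1)) x g) by (apply CPS_correct; [now apply hcoef_radius|exact Hx]).
apply is_CPS_unique with (fun n => - (a * (c - b) / c) * hcoef (a + 1) b (c + 1) n)%C x.
2: now apply is_CPS_scal.
apply is_CPS_ext with (fun n =>
  cder h n + (-(1) * cshift (cder h) n + - a * h n))%C.
- intros n. rewrite cshift_cder.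
  replace (- (a * (c - b) / c) * hcoef (a + 1) b (c + 1) n)%C
    with (- ((c - b) / c) * (a * hcoef (a + 1) b (c + 1) n))%C
    by (field; now apply Im_nz).
  rewrite hcoef_shift_ac by exact Hc. fold h. unfold cder, h. rewrite hcoef_S by exact Hc.
  pose proof (plus_INR_nz c n Hc). pose proof (INR_S_nz n). pose proof (Im_nz _ Hc). field; auto.
- replace (_ - _)%C with (k1 * f1 + (-(1) * (x * (k1 * f1)) + - a * f))%C by ring.
  exact (is_CPS_plus _ _ _ _ _ S1 
    (is_CPS_plus _ _ _ _ _ (is_CPS_scal _ _ _ _ (is_CPS_shift _ _ _ S1)) (is_CPS_scal _ _ _ _ S0))).
Qed.

(* The hypergeometric equation after the substitution [s = w / (1 + w)], with
   [b] standing for the original [c - b]. *)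
Lemma hyp_ode_pfaff a b c (s : R) : Im c <> 0 -> Rabs s < 1 ->
  let B := (c - b)%C in
  (s * (a * B / c * ((a + 1) * (B + 1) / (c + 1)) * CPS (hcoef (a + 1 + 1) b (c + 1 + 1)) s)
   + (c * (1 - s) + (a + B + 1) * s) * (- (a * B / c) * CPS (hcoef (a + 1) b (c + 1)) s)
   + a * B * CPS (hcoef a b c) s)%C = 0.
Proof.
intros Hc Hs B.
assert (Hc1 : Im (c + 1)%C <> 0) by (unfold Im in *; simpl; lra).
assert (Hc2 : Im (c + 1 + 1)%C <> 0) by (unfold Im in *; simpl; lra).
set (f := CPS (hcoef a b c) s). set (k1 := (a * B / c)%C).
set (k2 := ((a + 1) * (B + 1) / (c + 1))%C).
set (f1 := CPS (hcoef (a + 1) b (c + 1)) s).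
set (f2 := CPS (hcoef (a + 1 + 1) b (c + 1 + 1)) s).
set (h := hcoef a b c). set (h1 := hcoef (a + 1) b (c + 1)).
set (h2 := hcoef (a + 1 + 1) b (c + 1 + 1)).
assert (S0 : is_CPS h s f) by (apply CPS_correct; [now apply hcoef_radius|exact Hs]).
assert (S1 : is_CPS h1 s f1) by (apply CPS_correct; [now apply hcoef_radius|exact Hs]).
assert (S2 : is_CPS h2 s f2) by (apply CPS_correct; [now apply hcoef_radius|exact Hs]).
pose proof (Im_nz _ Hc) as c0. pose proof (Im_nz _ Hc1) as c10.
apply is_CPS_zero with s.
apply is_CPS_ext with (fun n =>
  (k1 * k2) * cshift h2 n + (- (c * k1) * h1 n +
   (- (k1 * (a + B + 1 - c)) * cshift h1 n + a * B * h n)))%C.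
- intros [|m].
  { cbn [cshift]. unfold h, h1. rewrite !hcoef_0. unfold k1. field; auto. }
  (* At index [S m] all four terms reduce to multiples of [h1 m]; index 0 is separate because the
     shifted sequences vanish there. *)
  cbn [cshift].
  replace (k1 * k2 * h2 m)%C with (k1 * ((B + 1) / (c + 1)) * ((a + 1) * h2 m))%C
    by (unfold k2; field; auto).
  unfold h2. rewrite hcoef_shift_ac by exact Hc1. fold h1.
  assert (E0 : (a * B * h (S m) = k1 * a * (b + INR m) / INR (S m) * h1 m)%C).
  { unfold h. rewrite hcoef_S by exact Hc. unfold k1.
    replace (a * B / c * a * (b + INR m) / INR (S m) * h1 m)%C
      with (a * B / c * (b + INR m) / INR (S m) * (a * h1 m))%C
      by (pose proof (INR_S_nz m); field; auto).
    unfold h1. rewrite hcoef_shift_ac by exact Hc.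
    pose proof (plus_INR_nz c m Hc). pose proof (INR_S_nz m). field; auto. }
  rewrite E0. unfold h1 at 2. rewrite hcoef_S by exact Hc1. fold h1.
  unfold B, k1.
  pose proof (plus_INR_nz (c + 1) m Hc1). pose proof (INR_S_nz m) as m0.
  rewrite S_INR, RtoC_plus in *. field; auto.
- match goal with |- is_CPS _ _ ?l => replace l with ((k1 * k2) * (s * f2) + (- (c * k1) * f1 +
   (- (k1 * (a + B + 1 - c)) * (s * f1) + a * B * f)))%C by ring end.
  exact (is_CPS_plus _ _ _ _ _ (is_CPS_scal _ _ _ _ (is_CPS_shift _ _ _ S2)) 
    (is_CPS_plus _ _ _ _ _ (is_CPS_scal _ _ _ _ S1) 
    (is_CPS_plus _ _ _ _ _ (is_CPS_scal _ _ _ _ (is_CPS_shift _ _ _ S1)) (is_CPS_scal _ _ _ _ S0)))).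
Qed.

(** * The equation in the variable [w = - x], and Pfaff's transformation *)

(** Common interface of the series near 0 and of its Pfaff form on the half-line: whatever is
    derived from it alone can be used to compare the two. *)
Definition hyp_family (D : R -> Prop) (F : C -> C -> C -> R -> C) : Prop :=
  forall a b c w, Im c <> 0 -> D w ->
  is_cderiv (F a b c) w (- (a * b / c) * F (a + 1) (b + 1) (c + 1) w)%C /\
  (w * (1 + w) * (a * b / c * ((a + 1) * (b + 1) / (c + 1))
                  * F (a + 1 + 1) (b + 1 + 1) (c + 1 + 1) w)
   + (c + (a + b + 1) * w) * (- (a * b / c) * F (a + 1) (b + 1) (c + 1) w)
   + a * b * F a b c w)%C = 0.

Fixpoint family_jet (F : C -> C -> C -> R -> C) (a b c : C) (n : nat) (w : R) : C :=
  match n with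
  | O => F a b c w
  | S m => - (a * b / c) * family_jet F (a + 1) (b + 1) (c + 1) m w
  end%C.

Lemma family_jet_hyp_jet (D : R -> Prop) F W :
  hyp_family D F -> (forall w, 0 <= w <= W -> D w) ->
  forall a b c, Im c <> 0 -> hyp_jet a b c W (family_jet F a b c).
Proof.
intros HF HD.
assert (Hc1 : forall c, Im c <> 0 -> Im (c + 1)%C <> 0)
  by (intros c Hc; unfold Im in *; simpl; lra).
intros a b c Hc; split; intros n; revert a b c Hc; induction n as [|n IH]; intros a b c Hc w Hw.
- apply (proj1 (HF a b c w Hc (HD w Hw))).
- apply is_cderiv_scal. apply IH; auto.
- pose proof (proj2 (HF a b c w Hc (HD w Hw))) as E. simpl.
  apply eq_trans with (2 := E).
  assert (c <> 0) by now apply Im_nz. assert ((c + 1)%C <> 0) by now apply Im_nz, Hc1.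
  field; auto.
- pose proof (IH (a + 1) (b + 1) (c + 1) (Hc1 c Hc) w Hw)%C as E.
  rewrite S_INR, RtoC_plus.
  transitivity (- (a * b / c) * 0)%C; [|ring]. rewrite <- E. cbn [family_jet]. ring.
Qed.

Definition Psi (a b c : C) (w : R) : C := CPS (hcoef a b c) (- w).

(* Pfaff's form of [Psi]: it converges on the whole half-line [0 <= w]. *)
Definition Phi (a b c : C) (w : R) : C :=
  (Cexp (- a * ln (1 + w)) * CPS (hcoef a (c - b) c) (w / (1 + w)))%C.

Lemma Psi_family : hyp_family (fun w => Rabs w < 1) Psi.
Proof.
intros a b c w Hc Hw. rewrite <- Rabs_Ropp in Hw. split.
- eapply is_cderiv_eq.
  + apply (is_cderiv_comp (CPS (hcoef a b c)) Ropp w).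
    * now apply is_cderiv_hyp.
    * assert (D : is_derive (fun t => - t) w (- (1))) by (auto_derive; [exact I|ring]).
      exact D.
  + unfold Psi. rewrite RtoC_opp. ring.
- pose proof (hyp_ode a b c _ Hc Hw) as E. rewrite RtoC_opp in E. unfold Psi.
  transitivity (- (0))%C; [|ring]. rewrite <- E. ring.
Qed.

Lemma pfaff_variable w : 0 <= w -> Rabs (w / (1 + w)) < 1.
Proof.
intros Hw. rewrite Rabs_pos_eq by (apply Rdiv_le_0_compat; lra).
apply Rlt_div_l; lra.
Qed.

Lemma Cexp_shift a w : 0 <= w ->
  Cexp (- (a + 1) * ln (1 + w)) = (Cexp (- a * ln (1 + w)) * / (1 + w))%C.
Proof.
intros Hw. replace (- (a + 1) * ln (1 + w))%C with (- a * ln (1 + w) + RtoC (- ln (1 + w)))%C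
  by (rewrite RtoC_opp; ring).
rewrite Cexp_plus, Cexp_RtoC, exp_Ropp, exp_ln by lra.
now rewrite RtoC_inv, RtoC_plus by lra.
Qed.

(** With [s = w / (1 + w)] one has [1 - s = 1 / (1 + w)]: [hyp_contiguous] gives the derivative,
    [hyp_ode_pfaff] the equation, both up to the elementary factor. *)
Lemma Phi_family : hyp_family (fun w => 0 <= w) Phi.
Proof.
intros a b c w Hc Hw. pose proof (pfaff_variable w Hw) as Hs.
assert (c0 : c <> 0) by now apply Im_nz.
assert (Hc1 : Im (c + 1)%C <> 0) by (unfold Im in *; simpl; lra).
assert (c10 : (c + 1)%C <> 0) by now apply Im_nz.
assert (w1 : (1 + RtoC w)%C <> 0) by (rewrite <- RtoC_plus; apply RtoC_nz; lra).
assert (Ew : RtoC (w / (1 + w)) = (w / (1 + w))%C)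
  by (rewrite RtoC_div, RtoC_plus by lra; reflexivity).
assert (D1 : is_derive (fun t => ln (1 + t)) w (/ (1 + w))) by (auto_derive; [lra|field; lra]).
assert (D2 : is_derive (fun t => t / (1 + t)) w (/ ((1 + w) * (1 + w))))
  by (auto_derive; [lra|field; lra]).
split.
- eapply is_cderiv_eq.
  + apply is_cderiv_mult.
    * apply is_cderiv_Cexp. apply is_cderiv_scal. apply is_cderiv_RtoC. exact D1.
    * apply (is_cderiv_comp (CPS (hcoef a (c - b) c)) (fun t => t / (1 + t)) w).
      { now apply is_cderiv_hyp. }
      { exact D2. }
  + pose proof (hyp_contiguous a (c - b) c _ Hc Hs) as E.
    unfold Phi. rewrite Cexp_shift by exact Hw.
    replace (c + 1 - (b + 1))%C with (c - b)%C by ring.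
    set (f := CPS (hcoef a (c - b) c) (w / (1 + w))) in *.
    set (f1 := CPS (hcoef (a + 1) (c - b + 1) (c + 1)) (w / (1 + w))) in *.
    set (g := CPS (hcoef (a + 1) (c - b) (c + 1)) (w / (1 + w))) in *.
    set (e := Cexp (- a * ln (1 + w))).
    replace (- (a * b / c) * (e * / (1 + w) * g))%C
      with (e * / (1 + w) * (- (a * (c - (c - b)) / c) * g))%C by (field; auto).
    rewrite <- E, Ew, !RtoC_inv, RtoC_mult, RtoC_plus by nra. field; auto.
- pose proof (hyp_ode_pfaff a (c - b) c _ Hc Hs) as E. cbv zeta in E.
  replace (c - (c - b))%C with b in E by ring. rewrite Ew in E.
  unfold Phi. rewrite !Cexp_shift by exact Hw.
  replace (c + 1 + 1 - (b + 1 + 1))%C with (c - b)%C by ring.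
  replace (c + 1 - (b + 1))%C with (c - b)%C by ring.
  transitivity (Cexp (- a * ln (1 + w)) * 0)%C; [|ring].
  rewrite <- E. field; auto.
Qed.

Lemma Psi_0 a b c : Psi a b c 0 = 1.
Proof. unfold Psi. rewrite Ropp_0, CPS_0. apply hcoef_0. Qed.

Lemma Phi_0 a b c : Phi a b c 0 = 1.
Proof.
unfold Phi. replace (0 / (1 + 0)) with 0 by field. rewrite Rplus_0_r, ln_1, CPS_0, hcoef_0.
rewrite Cmult_0_r, Cexp_0. ring.
Qed.

(** Only [Re c] is fixed beforehand: [K] and [R0] must serve all values of [Im c], which tends to
    infinity with [alpha]. The number [m] of differentiations is chosen to make both real parts
    nonnegative. *)
Lemma Phi_bound (a b : C) (cr : R) :
  exists K R0, 0 <= K /\ 1 <= R0 /\ forall c w,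
    Re c = cr -> 1 <= Rabs (Im c) -> 0 <= w -> w * R0 <= Rabs (Im c) ->
    Cmod (Phi a b c w - 1) <= K * (w / Rabs (Im c)).
Proof.
destruct (INR_unbounded (Rmax (- cr) (- Re (a + b + 1)%C))) as [m Hm].
pose proof (Rmax_l (- cr) (- Re (a + b + 1)%C)). pose proof (Rmax_r (- cr) (- Re (a + b + 1)%C)).
pose proof (pos_INR m).
destruct (hyp_jet_bound m a b cr) as [K [R0 [HK [HR0 HB]]]]; try lra.
exists K, R0. split; [exact HK|split; [exact HR0|]]. intros c w Ec HT Hw HR.
assert (Hc : Im c <> 0) by (intros E; rewrite E, Rabs_R0 in HT; lra).
assert (HJ : hyp_jet a b c w (family_jet Phi a b c))
  by (apply family_jet_hyp_jet with (1 := Phi_family); [intros t Ht; apply Ht|exact Hc]).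
specialize (HB c w _ Ec HT Hw HR HJ). simpl in HB. rewrite Phi_0, Cmod_1 in HB. lra.
Qed.

(* [Psi - Phi] solves the equation and vanishes at 0, so [hyp_jet_bound] forces it to be 0. *)
Lemma pfaff (a b c : C) : 1 <= Rabs (Im c) ->
  exists w0, 0 < w0 /\ forall w, 0 <= w < w0 -> hyp2F1 a b c (RtoC (- w)) = Phi a b c w.
Proof.
intros HT.
destruct (INR_unbounded (Rmax (- Re c) (- Re (a + b + 1)%C))) as [m Hm].
pose proof (Rmax_l (- Re c) (- Re (a + b + 1)%C)). pose proof (Rmax_r (- Re c) (- Re (a + b + 1)%C)).
pose proof (pos_INR m).
destruct (hyp_jet_bound m a b (Re c)) as [K [R0 [HK [HR0 HB]]]]; try lra.
assert (Hc : Im c <> 0) by (intros E; rewrite E, Rabs_R0 in HT; lra).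
assert (Hi : 0 < / R0) by (apply Rinv_0_lt_compat; lra).
assert (Hi1 : / R0 <= 1) by (rewrite <- Rinv_1; apply Rinv_le_contravar; lra).
(* Below [/ R0 <= 1] the series converges, and [w * R0 <= 1 <= |Im c|] is the range of the
   estimate. *)
exists (/ R0). split; [exact Hi|]. intros w Hw.
rewrite hyp2F1_RtoC. fold (Psi a b c w).
assert (HR : w * R0 <= Rabs (Im c)).
{ apply Rle_trans with (2 := HT). apply Rle_trans with (/ R0 * R0).
  - apply Rmult_le_compat_r; lra.
  - rewrite Rinv_l by lra. lra. }
assert (HJ : hyp_jet a b c w
  (fun n t => family_jet Psi a b c n t - family_jet Phi a b c n t)%C).
{ apply hyp_jet_minus.
  - apply family_jet_hyp_jet with (1 := Psi_family); [|exact Hc].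
    intros t Ht. apply Rabs_def1; lra.
  - apply family_jet_hyp_jet with (1 := Phi_family); [intros t Ht; apply Ht|exact Hc]. }
specialize (HB c w _ eq_refl HT (proj1 Hw) HR HJ). simpl in HB.
rewrite Psi_0, Phi_0 in HB.
assert (E11 : Cmod (1 - 1)%C = 0) by (unfold Cminus; rewrite Cplus_opp_r; apply Cmod_0).
rewrite E11, Rmult_0_r in HB.
assert (E : (Psi a b c w - Phi a b c w - (1 - 1))%C = 0).
{ apply Cmod_eq_0. apply Rle_antisym; [exact HB|apply Cmod_ge_0]. }
replace (Psi a b c w) with (Psi a b c w - Phi a b c w - (1 - 1) + Phi a b c w)%C by ring.
rewrite E. ring.
Qed.

(** * Real-analytic continuation *)

Definition ranalytic (f : R -> R) (x : R) : Prop :=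
  exists a, Rbar_lt 0 (CV_radius a) /\ locally x (fun t => f t = PSeries a (t - x)).

Lemma near_in_radius a x : Rbar_lt 0 (CV_radius a) ->
  locally x (fun t => Rbar_lt (Rabs (t - x)) (CV_radius a)).
Proof.
intros H. destruct (CV_radius a) as [r| |]; [|apply filter_forall; easy|easy].
exists (mkposreal r H). intros t Ht. exact Ht.
Qed.

Lemma ranalytic_plus f g x : ranalytic f x -> ranalytic g x ->
  ranalytic (fun t => f t + g t) x.
Proof.
intros [a [Ha Ea]] [b [Hb Eb]]. exists (PS_plus a b). split.
- apply Rbar_lt_le_trans with (2 := CV_radius_plus a b).
  now apply Rbar_min_case.
- generalize (filter_and _ _ (filter_and _ _ Ea Eb)
    (filter_and _ _ (near_in_radius a x Ha) (near_in_radius b x Hb))).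
  apply filter_imp. intros t [[-> ->] [Ra Rb]].
  symmetry. apply PSeries_plus; now apply CV_radius_inside.
Qed.

Lemma ranalytic_mult f g x : ranalytic f x -> ranalytic g x ->
  ranalytic (fun t => f t * g t) x.
Proof.
intros [a [Ha Ea]] [b [Hb Eb]]. exists (PS_mult a b).
pose proof (near_in_radius a 0 Ha) as Na. pose proof (near_in_radius b 0 Hb) as Nb.
split.
(* The Cauchy product converges at [e / 2], so its terms tend to 0 there, which is impossible
   outside the disk of convergence. *)
- destruct (filter_and _ _ Na Nb) as [e He].
  assert (e0 := cond_pos e).
  assert (Hx : Rabs (e / 2) < e) by (rewrite Rabs_pos_eq; lra).
  destruct (He (e / 2)) as [H1 H2].
  { unfold ball; simpl; unfold AbsRing_ball, abs, minus, plus, opp; simpl.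
    now rewrite Ropp_0, Rplus_0_r. }
  rewrite Rminus_0_r in H1, H2.
  pose proof (ex_pseries_mult a b _ H1 H2) as Hm.
  apply Rbar_lt_le_trans with (Finite (e / 2)); [simpl; lra|].
  apply Rbar_not_lt_le. intros Hlt.
  apply (CV_disk_outside (PS_mult a b) (e / 2)).
  + rewrite Rabs_pos_eq; [exact Hlt|lra].
  + apply ex_series_lim_0. now apply ex_pseries_R.
- generalize (filter_and _ _ (filter_and _ _ Ea Eb)
    (filter_and _ _ (near_in_radius a x Ha) (near_in_radius b x Hb))).
  apply filter_imp. intros t [[-> ->] [Ra Rb]].
  symmetry. now apply PSeries_mult.
Qed.

Lemma ranalytic_const k x : ranalytic (fun _ => k) x.
Proof.
exists (fun n => match n with O => k | S _ => 0 end).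
assert (E : forall y, is_pseries (fun n => match n with O => k | S _ => 0 end) y k).
{ intros y. apply is_pseries_R.
  apply filterlim_ext with (fun _ => k); [|apply filterlim_const].
  induction x0 as [|n IH]; [rewrite sum_O; simpl; ring|].
  rewrite sum_Sn, <- IH. unfold plus; simpl; ring. }
split.
- apply Rbar_lt_le_trans with (Finite 1); [simpl; lra|].
  apply Rbar_not_lt_le. intros Hlt.
  eapply (CV_disk_outside _ 1).
  + rewrite Rabs_pos_eq; [exact Hlt|lra].
  + apply ex_series_lim_0. apply ex_pseries_R. eexists. apply E.
- apply filter_forall. intros t. symmetry. apply is_pseries_unique, E.
Qed.

Lemma ranalytic_exp x : ranalytic exp x.
Proof.
assert (H : ranalytic (fun t => exp x * exp (t - x)) x).
{ apply ranalytic_mult; [apply ranalytic_const|].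
  exists (fun n => / INR (fact n)). split.
  - apply Rbar_lt_le_trans with (Finite 1); [simpl; lra|].
    apply Rbar_not_lt_le. intros Hlt.
    eapply (CV_disk_outside _ 1).
    + rewrite Rabs_pos_eq; [exact Hlt|lra].
    + apply ex_series_lim_0. apply ex_pseries_R. eexists. apply is_exp_Reals.
  - apply filter_forall. intros t. symmetry. apply is_pseries_unique, is_exp_Reals. }
destruct H as [a [Ha Ea]]. exists a. split; [exact Ha|].
revert Ea. apply filter_imp. intros t <-. rewrite <- exp_plus. f_equal.
symmetry. apply Rplus_minus.
Qed.

Lemma ranalytic_derive f x : ranalytic f x -> ex_derive f x /\ ranalytic (Derive f) x.
Proof.
intros [a [Ha Ea]].
assert (HD : locally x (fun t => is_derive f t (PSeries (PS_derive a) (t - x)))).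
{ generalize (filter_and _ _ (locally_locally _ _ Ea) (near_in_radius a x Ha)).
  apply filter_imp. intros t [E R].
  apply is_derive_ext_loc with (fun t => PSeries a (t - x)).
  - revert E. apply filter_imp. now intros s ->.
  - assert (D : is_derive (fun t => t - x) t 1) by (auto_derive; [exact I|ring]).
    pose proof (is_derive_comp (PSeries a) (fun t => t - x) t _ _ (is_derive_PSeries a _ R) D) as DC.
    replace (PSeries (PS_derive a) (t - x)) with (scal 1 (PSeries (PS_derive a) (t - x))); [exact DC|].
    apply (scal_one (PSeries (PS_derive a) (t - x))). }
split.
- eexists. apply (locally_singleton _ _ HD).
- exists (PS_derive a). split; [now rewrite CV_radius_derive|].
  revert HD. apply filter_imp. intros t Ht. now apply is_derive_unique.
Qed.

Lemma PSeries_right_zero_0 a r : Rbar_lt 0 (CV_radius a) -> 0 < r ->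
  (forall t, 0 < t < r -> PSeries a t = 0) -> a 0%nat = 0.
Proof.
intros Ha Hr Hz. rewrite <- PSeries_0.
destruct (Req_dec (PSeries a 0) 0) as [E|E]; [exact E|exfalso].
assert (Hc : continuity_pt (PSeries a) 0)
  by (apply PSeries_continuity; now rewrite Rabs_R0).
destruct (Hc (Rabs (PSeries a 0)) (Rabs_pos_lt _ E)) as [d [d0 Hd]].
set (t := Rmin d r / 2).
assert (Ht : 0 < t < d /\ t < r).
{ pose proof (Rmin_l d r). pose proof (Rmin_r d r).
  assert (0 < Rmin d r) by (apply Rmin_pos; lra). unfold t; lra. }
specialize (Hd t). simpl in Hd. unfold R_dist in Hd.
rewrite Hz in Hd by lra. rewrite Rminus_0_l, Rabs_Ropp in Hd.
refine (Rlt_irrefl _ (Hd _)). split; [split; [exact I|lra]|].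
rewrite Rminus_0_r, Rabs_pos_eq; lra.
Qed.

(** One-sided vanishing is all that the supremum argument below provides. The constant term is 0 by
    continuity; dividing by the variable lowers the index. *)
Lemma PSeries_right_zero n : forall a r, Rbar_lt 0 (CV_radius a) -> 0 < r ->
  (forall t, 0 < t < r -> PSeries a t = 0) -> a n = 0.
Proof.
induction n as [|n IH]; intros a r Ha Hr Hz.
all: pose proof (PSeries_right_zero_0 a r Ha Hr Hz) as a0.
- exact a0.
- apply (IH (PS_decr_1 a) r); [now rewrite CV_radius_decr_1|exact Hr|].
  intros t Ht. specialize (Hz t Ht). rewrite PSeries_decr_1_aux in Hz by exact a0.
  apply Rmult_integral in Hz. destruct Hz; [lra|assumption].
Qed.

(** At the supremum [m] of the points where [f] is nonzero, [f] vanishes on the right, so its Taylor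
    series at [m] is 0 and [f] vanishes also on an interval to the left, a contradiction. *)
Lemma ranalytic_identity f T :
  (forall x, ranalytic f x) -> (forall t, T < t -> f t = 0) -> forall t, f t = 0.
Proof.
intros Hf HT t0. destruct (Req_dec (f t0) 0) as [E|E]; [exact E|exfalso].
destruct (completeness (fun t => f t <> 0)) as [m [Hm1 Hm2]].
- exists T. intros t Ht. apply Rnot_lt_le. intros Hlt. now apply Ht, HT.
- now exists t0.
- assert (Hm : forall t, m < t -> f t = 0).
  { intros t Ht. destruct (Req_dec (f t) 0) as [E'|E']; [exact E'|].
    specialize (Hm1 t E'). lra. }
  destruct (Hf m) as [a [Ha [e He]]]. assert (e0 := cond_pos e).
  assert (Hball : forall t, Rabs (t - m) < e -> f t = PSeries a (t - m)) by exact He.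
  assert (Za : forall n, a n = 0).
  { intros n. apply PSeries_right_zero with (r := e); [exact Ha|exact e0|].
    intros t Ht. replace t with (m + t - m) by ring. rewrite <- Hball, Hm; [reflexivity|lra|].
    replace (m + t - m) with t by ring. rewrite Rabs_pos_eq; lra. }
  assert (m <= m - e); [|lra].
  apply Hm2. intros t Ht. apply Rnot_lt_le. intros Hlt. apply Ht.
  destruct (Rlt_le_dec m t) as [H|H]; [now apply Hm|].
  rewrite Hball by (apply Rabs_def1; lra).
  rewrite (PSeries_ext a (fun _ => 0)) by exact Za. apply PSeries_const_0.
Qed.

Definition canalytic (f : R -> C) : Prop :=
  forall x, ranalytic (fun t => Re (f t)) x /\ ranalytic (fun t => Im (f t)) x.

Lemma ranalytic_ext f g x : (forall t, f t = g t) -> ranalytic f x -> ranalytic g x.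
Proof.
intros H [a [Ha Ea]]. exists a. split; [exact Ha|]. revert Ea. apply filter_imp.
intros t. now rewrite H.
Qed.

Lemma canalytic_plus f g : canalytic f -> canalytic g -> canalytic (fun t => f t + g t)%C.
Proof. intros Hf Hg x. destruct (Hf x), (Hg x). split; now apply ranalytic_plus. Qed.

Lemma canalytic_mult f g : canalytic f -> canalytic g -> canalytic (fun t => f t * g t)%C.
Proof.
intros Hf Hg x. destruct (Hf x) as [f1 f2], (Hg x) as [g1 g2]. split.
- apply ranalytic_ext with (fun t => Re (f t) * Re (g t) + -1 * (Im (f t) * Im (g t))).
  { intros t. rewrite Re_mult. ring. }
  apply ranalytic_plus; [now apply ranalytic_mult|].
  apply ranalytic_mult; [apply ranalytic_const|now apply ranalytic_mult].
- apply ranalytic_plus; now apply ranalytic_mult.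
Qed.

Lemma canalytic_RtoC f : (forall x, ranalytic f x) -> canalytic (fun t => RtoC (f t)).
Proof. intros Hf x. split; [apply Hf|apply (ranalytic_const 0)]. Qed.

Lemma canalytic_const k : canalytic (fun _ => k).
Proof. intros x. split; apply ranalytic_const. Qed.

Definition cD (f : R -> C) (t : R) : C :=
  (Derive (fun s => Re (f s)) t, Derive (fun s => Im (f s)) t).

Lemma canalytic_cD f : canalytic f -> canalytic (cD f) /\ forall x, is_cderiv f x (cD f x).
Proof.
intros Hf. split; intros x; destruct (Hf x) as [A B];
  apply ranalytic_derive in A; apply ranalytic_derive in B.
- split; [apply A|apply B].
- split; apply Derive_correct; [apply A|apply B].
Qed.

Lemma cD_eq f x l : is_cderiv f x l -> cD f x = l.
Proof. intros [A B]. apply C_eq; now apply is_derive_unique. Qed.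

(** A horizontal line of codes is a ray of constant argument. Increments along it are real, so a
    complex expansion splits into two real power series. *)
Lemma analytic_on_line (D : C -> Prop) f z0 :
  analytic_on D f -> (forall t : R, D (z0 + t)%C) -> canalytic (fun t => f (z0 + t)%C).
Proof.
intros Hf HD x.
destruct (Hf _ (HD x)) as [a [r [Hr Ha]]].
assert (Hs : forall t, Rabs (t - x) < r -> is_CPS a (t - x) (f (z0 + t)%C)).
{ intros t Ht. specialize (Ha (z0 + t)%C).
  replace (z0 + t - (z0 + x))%C with (RtoC (t - x)) in Ha by (rewrite RtoC_minus; ring).
  rewrite Cmod_R in Ha. specialize (Ha Ht).
  unfold is_pseries in Ha.
  assert (E : forall n, (scal (pow_n (K := C_AbsRing) (RtoC (t - x)) n) (a n) : C)
     = (RtoC ((t - x) ^ n) * a n)%C).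
  { intros n.
    assert (P : forall k, pow_n (K := C_AbsRing) (RtoC (t - x)) k = RtoC ((t - x) ^ k)).
    { induction k as [|k IH]; [reflexivity|].
      change (pow_n (K := C_AbsRing) (RtoC (t - x)) (S k))
        with (RtoC (t - x) * pow_n (K := C_AbsRing) (RtoC (t - x)) k)%C.
      rewrite IH, <- RtoC_mult. reflexivity. }
    rewrite P. reflexivity. }
  assert (Hsum : forall N, sum_n (fun k => scal (pow_n (K := C_AbsRing) (RtoC (t - x)) k) (a k)) N
     = (sum_n (fun k => Re (a k) * (t - x) ^ k) N, sum_n (fun k => Im (a k) * (t - x) ^ k) N)).
  { induction N as [|N IH].
    - rewrite !sum_O. rewrite E. apply C_eq; unfold Re, Im; simpl; ring.
    - rewrite !sum_Sn, IH, E. apply C_eq; unfold Re, Im, plus; simpl; ring. }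
  split; apply is_pseries_R.
  - apply filterlim_ext with (fun N => Re (sum_n (fun k => scal (pow_n (K := C_AbsRing) (RtoC (t - x)) k) (a k)) N)).
    { intros N. now rewrite Hsum. }
    eapply filterlim_comp; [exact Ha|]. intros P [e He]. exists e. intros y Hy. apply He, Hy.
  - apply filterlim_ext with (fun N => Im (sum_n (fun k => scal (pow_n (K := C_AbsRing) (RtoC (t - x)) k) (a k)) N)).
    { intros N. now rewrite Hsum. }
    eapply filterlim_comp; [exact Ha|]. intros P [e He]. exists e. intros y Hy. apply He, Hy. }
assert (G : forall b : nat -> R, (forall t, Rabs (t - x) < r -> ex_pseries b (t - x)) ->
  Rbar_lt 0 (CV_radius b)).
{ intros b Hb. apply Rbar_lt_le_trans with (Finite (r / 2)); [simpl; lra|].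
  apply Rbar_not_lt_le. intros Hlt.
  apply (CV_disk_outside b (r / 2)).
  + rewrite Rabs_pos_eq; [exact Hlt|lra].
  + apply ex_series_lim_0. apply ex_pseries_R. replace (r / 2) with (x + r / 2 - x) by ring.
    apply Hb. replace (x + r / 2 - x) with (r / 2) by ring. rewrite Rabs_pos_eq; lra. }
split.
- exists (fun n => Re (a n)). split.
  + apply G. intros t Ht. eexists. apply (Hs t Ht).
  + exists (mkposreal r Hr). intros t Ht. symmetry. apply is_pseries_unique, (Hs t Ht).
- exists (fun n => Im (a n)). split.
  + apply G. intros t Ht. eexists. apply (Hs t Ht).
  + exists (mkposreal r Hr). intros t Ht. symmetry. apply is_pseries_unique, (Hs t Ht).
Qed.

(** * Uniqueness for the Gauss equation on the negative axis *)

(** Gronwall run backwards: [N = |D|^2 + |D1|^2] satisfies [N' + K N >= 0], so [N * exp (K t)] is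
    nondecreasing, and it vanishes at [s]. The direction is that from [x] near infinity towards
    0. *)
Lemma ode2_unique (D D1 D2 : R -> C) (P Q s : R) :
  0 <= P -> 0 <= Q ->
  (forall t, is_cderiv D t (D1 t)) -> (forall t, is_cderiv D1 t (D2 t)) ->
  (forall t, Cmod (D2 t) <= P * Cmod (D1 t) + Q * Cmod (D t)) ->
  D s = 0 -> D1 s = 0 -> forall t, t <= s -> D t = 0.
Proof.
intros HP HQ H1 H2 HB E0 E1 t Ht.
set (N := fun t => Cmod (D t) ^ 2 + Cmod (D1 t) ^ 2).
set (N' := fun t => 2 * (Re (D t) * Re (D1 t) + Im (D t) * Im (D1 t))
   + 2 * (Re (D1 t) * Re (D2 t) + Im (D1 t) * Im (D2 t))).
assert (DN : forall t, is_derive N t (N' t)).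
{ intros u. apply (is_derive_plus (fun t => Cmod (D t) ^ 2) (fun t => Cmod (D1 t) ^ 2));
    now apply is_derive_Cmod2. }
(* With [x = |D|] and [y = |D1|]: [2xy + 2y(Py + Qx) <= (1 + Q)(x^2 + y^2) + 2P y^2]. *)
set (K := 1 + 2 * P + Q).
assert (HN : forall u, 0 <= N' u + K * N u).
{ intros u. pose proof (Cauchy_Schwarz_C (D u) (D1 u)) as C1.
  pose proof (Cauchy_Schwarz_C (D1 u) (D2 u)) as C2. specialize (HB u).
  apply Rabs_le_between in C1. apply Rabs_le_between in C2.
  pose proof (Cmod_ge_0 (D u)). pose proof (Cmod_ge_0 (D1 u)).
  assert (Cmod (D1 u) * Cmod (D2 u) <= Cmod (D1 u) * (P * Cmod (D1 u) + Q * Cmod (D u)))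
    by (apply Rmult_le_compat_l; assumption).
  unfold N', N, K. set (x := Cmod (D u)) in *. set (y := Cmod (D1 u)) in *.
  assert (0 <= (x - y) ^ 2) by apply pow2_ge_0.
  assert (0 <= Q * (x - y) ^ 2) by (apply Rmult_le_pos; assumption).
  assert (0 <= P * x ^ 2) by (apply Rmult_le_pos; [assumption|apply pow2_ge_0]).
  nra. }
assert (Ns : N s = 0) by (unfold N; rewrite E0, E1, Cmod_0; ring).
assert (Nt : N t <= 0).
{ destruct (Rle_lt_or_eq_dec t s Ht) as [Hlt|E]; [|rewrite E; lra].
  destruct (MVT_cor2 (fun u => N u * exp (K * u)) (fun u => (N' u + K * N u) * exp (K * u)) t s Hlt)
    as [u [Eu _]].
  { intros u _. apply is_derive_Reals.
    assert (DE : is_derive (fun u => exp (K * u)) u (K * exp (K * u))) by (auto_derive; [exact I|ring]).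
    pose proof (is_derive_Rmult N (fun u => exp (K * u)) u _ _ (DN u) DE) as DM.
    replace ((N' u + K * N u) * exp (K * u)) with (N' u * exp (K * u) + N u * (K * exp (K * u))) by ring.
    exact DM. }
  rewrite Ns in Eu.
  assert (0 <= (N' u + K * N u) * exp (K * u) * (s - t)).
  { apply Rmult_le_pos; [|lra]. apply Rmult_le_pos; [apply HN|apply Rlt_le, exp_pos]. }
  pose proof (exp_pos (K * t)). apply Rnot_lt_le. intros Hp.
  assert (0 < N t * exp (K * t)) by (now apply Rmult_lt_0_compat). lra. }
apply Cmod_eq_0. unfold N in Nt. pose proof (Cmod_ge_0 (D t)). pose proof (pow2_ge_0 (Cmod (D1 t))).
nra.
Qed.

(* The Gauss equation on the ray [x = - e^t]; [y1], [y2] are derivatives in [t]. *)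
Definition gauss_ode (al be ga : C) (t : R) (y y1 y2 : C) : C :=
  ((1 + RtoC (exp t)) * y2 + (ga - 1 + RtoC (exp t) * (al + be)) * y1
   + RtoC (exp t) * (al * be) * y)%C.

(** The continuation [y] is analytic but not given as a solution, while [h] is a solution not known
    to be analytic. So the identity theorem is applied to the Gauss operator on [y], which vanishes
    for large [t]; then [y] and [h] solve the same equation and agree beyond [T]. *)
Lemma gauss_continuation_unique al be ga (y h h1 h2 : R -> C) (T : R) :
  canalytic y -> (forall t, is_cderiv h t (h1 t)) -> (forall t, is_cderiv h1 t (h2 t)) ->
  (forall t, gauss_ode al be ga t (h t) (h1 t) (h2 t) = 0) ->
  (forall t, T < t -> y t = h t) -> forall t, y t = h t.
Proof.
intros Hy Hh Hh1 Hode HT.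
destruct (canalytic_cD y Hy) as [Hy1 D1]. destruct (canalytic_cD _ Hy1) as [Hy2 D2].
assert (Hnear : forall t, T < t -> locally t (fun s => T < s)).
{ intros t Ht. exists (mkposreal (t - T) ltac:(lra)). intros s Hs.
  assert (Rabs (s - t) < t - T) by exact Hs. apply Rabs_lt_between in H. lra. }
assert (E1 : forall t, T < t -> cD y t = h1 t).
{ intros t Ht. apply cD_eq. apply is_cderiv_ext_loc with (2 := Hh t).
  generalize (Hnear t Ht). apply filter_imp. intros s Hs. symmetry. now apply HT. }
assert (E2 : forall t, T < t -> cD (cD y) t = h2 t).
{ intros t Ht. apply cD_eq. apply is_cderiv_ext_loc with (2 := Hh1 t).
  generalize (Hnear t Ht). apply filter_imp. intros s Hs. symmetry. now apply E1. }
set (Ly := fun t => gauss_ode al be ga t (y t) (cD y t) (cD (cD y) t)).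
assert (Hexp : canalytic (fun t => RtoC (exp t))) by (apply canalytic_RtoC, ranalytic_exp).
assert (HL : canalytic Ly).
{ unfold Ly, gauss_ode. repeat apply canalytic_plus; repeat apply canalytic_mult;
    try assumption; try apply canalytic_const;
    apply canalytic_plus; try apply canalytic_const; try assumption.
  apply canalytic_mult; [assumption|apply canalytic_const]. }
assert (L0 : forall t, Ly t = 0).
{ intros t. assert (Z : forall s, T < s -> Ly s = 0).
  { intros s Hs. unfold Ly. rewrite HT, E1, E2 by exact Hs. apply Hode. }
  apply C_eq.
  - apply (ranalytic_identity (fun s => Re (Ly s)) T); [intros x; apply (HL x)|].
    intros s Hs. now rewrite Z.
  - apply (ranalytic_identity (fun s => Im (Ly s)) T); [intros x; apply (HL x)|].
    intros s Hs. now rewrite Z. }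
intros t. destruct (Rlt_le_dec T t) as [Ht|Ht]; [now apply HT|].
assert (E : (y t - h t)%C = 0).
(* The constants are uniform in [t]: after division by [1 + e^t] only the factors [1 / (1 + e^t)]
   and [e^t / (1 + e^t)], both below 1, remain. *)
{ apply (ode2_unique (fun t => y t - h t)%C (fun t => cD y t - h1 t)%C (fun t => cD (cD y) t - h2 t)%C
    (Cmod (ga - 1) + Cmod (al + be)) (Cmod (al * be)) (T + 1)).
  - pose proof (Cmod_ge_0 (ga - 1)). pose proof (Cmod_ge_0 (al + be)). lra.
  - apply Cmod_ge_0.
  - intros s. now apply is_cderiv_minus.
  - intros s. now apply is_cderiv_minus.
  - intros s. set (e := exp s). assert (e0 : 0 < e) by apply exp_pos.
    set (dd := (y s - h s)%C). set (d1 := (cD y s - h1 s)%C). set (d2 := (cD (cD y) s - h2 s)%C).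
    assert (Ed : ((1 + e) * d2)%C = (- ((ga - 1 + e * (al + be)) * d1 + e * (al * be) * dd))%C).
    { pose proof (L0 s) as A. pose proof (Hode s) as B. unfold Ly in A. unfold gauss_ode in A, B.
      fold e in A, B. unfold dd, d1, d2.
      match type of A with ?u = _ => match type of B with ?v = _ =>
        assert (AB : (u - v)%C = 0) by (rewrite A, B; ring) end end.
      match goal with |- ?l = ?r => assert ((l - r)%C = 0) as AC; [rewrite <- AB; ring|] end.
      match goal with |- ?l = ?r => replace l with ((l - r) + r)%C by ring end.
      rewrite AC. ring. }
    apply (f_equal Cmod) in Ed. rewrite Cmod_opp, Cmod_mult in Ed.
    rewrite <- RtoC_plus, Cmod_R, Rabs_pos_eq in Ed by lra.
    apply Rmult_le_reg_l with (1 + e); [lra|]. rewrite Ed.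
    eapply Rle_trans; [apply Cmod_triangle|]. rewrite !Cmod_mult, Cmod_R, (Rabs_pos_eq e) by lra.
    rewrite <- (Cmod_mult al be).
    assert (Cmod (ga - 1 + e * (al + be)) <= Cmod (ga - 1) + e * Cmod (al + be)).
    { eapply Rle_trans; [apply Cmod_triangle|]. rewrite Cmod_mult, Cmod_R, Rabs_pos_eq by lra. lra. }
    pose proof (Cmod_ge_0 (ga - 1)). pose proof (Cmod_ge_0 (al + be)).
    pose proof (Cmod_ge_0 d1). pose proof (Cmod_ge_0 dd). pose proof (Cmod_ge_0 (al * be)).
    assert (Cmod (ga - 1 + e * (al + be)) * Cmod d1 <= (Cmod (ga - 1) + e * Cmod (al + be)) * Cmod d1)
      by (apply Rmult_le_compat_r; assumption).
    assert (0 <= e * (Cmod (ga - 1) * Cmod d1)) by (apply Rmult_le_pos; [lra|apply Rmult_le_pos; assumption]).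
    assert (0 <= Cmod (al + be) * Cmod d1) by (apply Rmult_le_pos; assumption).
    assert (0 <= Cmod (al * be) * Cmod dd) by (apply Rmult_le_pos; assumption).
    nra.
  - rewrite HT by lra. ring.
  - rewrite E1 by lra. ring.
  - lra. }
replace (y t) with ((y t - h t) + h t)%C by ring. rewrite E. ring.
Qed.

(** * Gauss solutions on a ray *)

Section Ray_solution.

Variables (al be ga a b c nu ka : C) (P0 P1 P2 : R -> C).
Hypothesis hP0 : forall w, 0 < w -> is_cderiv P0 w (P1 w).
Hypothesis hP1 : forall w, 0 < w -> is_cderiv P1 w (P2 w).
Hypothesis hode : forall w : R, 0 < w ->
  (w * (1 + w) * P2 w + (c + (a + b + 1) * w) * P1 w + a * b * P0 w)%C = 0.

Let w (t : R) := exp (- t).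
(** With [x = - e^t] and [w = - 1 / x], this is [(-x)^(-nu) * (1 + w)^ka], the elementary factor of
    a local solution at infinity; [mu] is its logarithmic derivative. *)
Let E (t : R) : C := Cexp (- nu * t + ka * ln (1 + w t)).
Let mu (t : R) : C := (- nu - ka * RtoC (w t / (1 + w t)))%C.
Let mu' (t : R) : C := (ka * RtoC (w t / ((1 + w t) * (1 + w t))))%C.
Let h (t : R) : C := (E t * P0 (w t))%C.
Let h1 (t : R) : C := (E t * (mu t * P0 (w t) - w t * P1 (w t)))%C.
Let h2 (t : R) : C := (E t * ((mu t * mu t + mu' t) * P0 (w t)
  + (w t - 2 * mu t * w t) * P1 (w t) + w t * w t * P2 (w t)))%C.

Lemma w_pos t : 0 < w t.
Proof. apply exp_pos. Qed.

Lemma is_derive_w t : is_derive w t (- w t).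
Proof. unfold w. auto_derive; [exact I|ring]. Qed.

Lemma is_cderiv_E t : is_cderiv E t (mu t * E t)%C.
Proof.
unfold E. pose proof (w_pos t).
assert (D : is_derive (fun t => ln (1 + w t)) t (- (w t / (1 + w t)))).
{ unfold w in *. auto_derive; [lra|field; lra]. }
eapply is_cderiv_eq.
- apply is_cderiv_Cexp. apply is_cderiv_plus; apply is_cderiv_scal.
  + apply is_cderiv_id.
  + apply is_cderiv_RtoC. exact D.
- unfold mu. rewrite RtoC_opp. ring.
Qed.

Lemma is_cderiv_mu t : is_cderiv mu t (mu' t).
Proof.
pose proof (w_pos t).
assert (D : is_derive (fun t => w t / (1 + w t)) t (- (w t / ((1 + w t) * (1 + w t))))).
{ unfold w in *. auto_derive; [lra|field; lra]. }
unfold mu. eapply is_cderiv_eq.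
- apply is_cderiv_minus; [apply is_cderiv_const|]. apply is_cderiv_scal.
  apply is_cderiv_RtoC. exact D.
- unfold mu'. rewrite RtoC_opp. ring.
Qed.

Lemma is_cderiv_h t : is_cderiv h t (h1 t).
Proof.
unfold h. eapply is_cderiv_eq.
- apply is_cderiv_mult; [apply is_cderiv_E|].
  apply (is_cderiv_comp P0 w); [apply hP0, w_pos|apply is_derive_w].
- unfold h1. rewrite RtoC_opp. ring.
Qed.

Lemma is_cderiv_h1 t : is_cderiv h1 t (h2 t).
Proof.
unfold h1. eapply is_cderiv_eq.
- apply is_cderiv_mult; [apply is_cderiv_E|]. apply is_cderiv_minus.
  + apply is_cderiv_mult; [apply is_cderiv_mu|].
    apply (is_cderiv_comp P0 w); [apply hP0, w_pos|apply is_derive_w].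
  + apply is_cderiv_mult; [apply is_cderiv_RtoC, is_derive_w|].
    apply (is_cderiv_comp P1 w); [apply hP1, w_pos|apply is_derive_w].
- unfold h2. rewrite RtoC_opp. ring.
Qed.

(** In the first case Euler's transformation has already replaced the numerator parameters [al],
    [al + 1 - ga] by [ga - be], [1 - be], leaving [al] only in [c] and in the elementary factor. *)
Lemma ray_solution_unique (y : R -> C) (T : R) :
  (nu = al /\ ka = (ga - be - al)%C /\ a = (ga - be)%C /\ b = (1 - be)%C /\ c = (al + 1 - be)%C) \/
  (nu = be /\ ka = 0 /\ a = be /\ b = (be + 1 - ga)%C /\ c = (be + 1 - al)%C) ->
  canalytic y -> (forall t, T < t -> y t = h t) -> forall t, y t = h t.
Proof.
intros Hpar Hy HT. apply (gauss_continuation_unique al be ga y h h1 h2 T); auto.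
- apply is_cderiv_h.
- apply is_cderiv_h1.
- intros t. pose proof (w_pos t) as Hw. pose proof (hode _ Hw) as O.
  assert (Ee : RtoC (exp t) = (/ w t)%C).
  { rewrite <- RtoC_inv by lra. f_equal. unfold w. rewrite exp_Ropp. field.
    apply Rgt_not_eq, exp_pos. }
  assert (w0 : RtoC (w t) <> 0) by (apply RtoC_nz; lra).
  assert (w1 : (1 + w t)%C <> 0) by (rewrite <- RtoC_plus; apply RtoC_nz; lra).
  (* The Gauss operator on [h] equals exactly [E] times the hypergeometric expression in [P0], [P1],
     [P2]. *)
  transitivity (E t * 0)%C; [|ring]. rewrite <- O.
  unfold gauss_ode, h, h1, h2, mu, mu'. rewrite Ee.
  rewrite !RtoC_div, !RtoC_mult, !RtoC_plus by nra.
  destruct Hpar as [[-> [-> [-> [-> ->]]]]|[-> [-> [-> [-> ->]]]]]; field; auto.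
Qed.

End Ray_solution.

Lemma Carg_pos r : 0 < r -> Carg (RtoC r) = 0.
Proof.
intros Hr. unfold Carg. simpl. rewrite Cmod_R, Rabs_pos_eq by lra.
destruct (Rlt_dec 0 0) as [H|_]; [lra|].
replace (r / r) with 1 by (field; lra). rewrite acos_1. ring.
Qed.

Lemma Cpower_pos r u : 0 < r -> Cpower (RtoC r) u = Cexp (u * ln r).
Proof.
intros Hr. unfold Cpower, Clog. rewrite Carg_pos, Cmod_R, Rabs_pos_eq by lra. reflexivity.
Qed.

Lemma pt_plus (z : Lsurf) (t : R) : pt (z + t)%C = (exp t * pt z)%C.
Proof. unfold pt. rewrite Cexp_plus, Cexp_RtoC. ring. Qed.

Lemma pt_rotate_PI (z : Lsurf) : pt (rotate PI z) = (- pt z)%C.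
Proof.
unfold pt, rotate. rewrite Cexp_plus.
replace (Cexp (Ci * PI)) with (- (1))%C; [ring|].
unfold Cexp; simpl. replace (0 * 0 + 1 * PI) with PI by ring. replace (0 * PI - 1 * 0) with 0 by ring.
rewrite exp_0, cos_PI, sin_PI. apply C_eq; simpl; ring.
Qed.

Lemma pt_nz (z : Lsurf) : pt z <> 0.
Proof. apply Cexp_nz. Qed.

(** The numerator parameters after transformation: free of [alpha] and the same at both singular
    points, which differ only in [c]. *)
Definition hyp_a (beta gamma : C) (j : index) : C :=
  match j with first => gamma - beta | second => beta end%C.
Definition hyp_b (beta gamma : C) (j : index) : C :=
  match j with first => 1 - beta | second => beta + 1 - gamma end%C.

(** Logarithm of the elementary factor, with [t = ln |x|] and [u = ln (1 - x)]; valid on both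
    rays. *)
Definition ray_exponent (alpha beta gamma : C) (j : index) (t u : R) : C :=
  match j with
  | first => - (gamma - beta) * t + (gamma - beta - alpha) * u
  | second => - beta * t
  end%C.

Definition infty_c (alpha beta : C) (j : index) : C :=
  match j with first => alpha + 1 - beta | second => beta + 1 - alpha end%C.
Definition one_c (alpha beta gamma : C) (j : index) : C :=
  match j with first => gamma + 1 - alpha - beta | second => alpha + beta + 1 - gamma end%C.

(** Euler's transformation: both sides are Pfaff forms of one series, taken with respect to either
    numerator parameter. *)
Lemma Phi_swap alpha beta gamma w :
  Phi alpha (alpha + 1 - gamma) (alpha + 1 - beta) w
  = (Cexp ((gamma - beta - alpha) * ln (1 + w))
     * Phi (gamma - beta) (1 - beta) (alpha + 1 - beta) w)%C.
Proof.
unfold Phi. rewrite Cmult_assoc, <- Cexp_plus.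
replace (alpha + 1 - beta - (alpha + 1 - gamma))%C with (gamma - beta)%C by ring.
replace (alpha + 1 - beta - (1 - beta))%C with alpha by ring.
f_equal; [f_equal; ring|].
apply CPS_ext. intros n. unfold hcoef. now rewrite (Cmult_comm (poch alpha n)).
Qed.

Lemma ln_1_exp t : ln (1 + exp (- t)) = - t + ln (1 + exp t).
Proof.
pose proof (exp_pos t).
replace (1 + exp (- t)) with (exp (- t) * (1 + exp t)).
- rewrite ln_mult, ln_exp; [ring|apply exp_pos|lra].
- rewrite Rmult_plus_distr_l, <- exp_plus. replace (- t + t) with 0 by ring. rewrite exp_0. ring.
Qed.

(** The code [rotate PI A + t] stands for [x = - e^t] with [arg (-x) = 0]. The defining series only
    gives large [t]; [ray_solution_unique] carries the formula to the very negative [t] needed when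
    [alpha] is large. *)
Lemma gauss_infty_ray eta beta gamma j (A : Lsurf) (Y : Lsurf -> C) :
  0 < eta < PI / 2 -> 1 <= Rabs (Im (infty_c (pt A) beta j)) ->
  gauss_infty_continuation eta beta gamma j A Y ->
  forall t : R, sigma_infty eta A (rotate PI A + t)%C /\
    Y (rotate PI A + t)%C =
    (Cexp (ray_exponent (pt A) beta gamma j t (ln (1 + exp t)))
     * Phi (hyp_a beta gamma j) (hyp_b beta gamma j) (infty_c (pt A) beta j) (exp (- t)))%C.
Proof.
intros Heta HT [Han Hval].
assert (Hx : forall t : R, (pt (rotate PI A + t) / pt A)%C = RtoC (- exp t)).
{ intros t. rewrite pt_plus, pt_rotate_PI, RtoC_opp. field. apply pt_nz. }
assert (Hsig : forall t : R, sigma_infty eta A (rotate PI A + t)%C).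
{ intros t. pose proof (exp_pos t).
  assert (E1 : (1 - pt (rotate PI A + t) / pt A)%C = RtoC (1 + exp t)).
  { rewrite Hx, RtoC_plus, RtoC_opp. ring. }
  unfold sigma_infty. rewrite E1, Carg_pos by lra. split; [|split].
  - intros Ec. specialize (Hx t). rewrite Ec in Hx.
    replace (pt A / pt A)%C with (RtoC 1) in Hx by (field; apply pt_nz).
    injection Hx. lra.
  - replace (arg (rotate PI A + t)%C) with (arg A + PI) by (unfold arg, rotate, Im; simpl; ring).
    lra.
  - lra. }
intros t. split; [apply Hsig|].
assert (Hc : Im (infty_c (pt A) beta j) <> 0)
  by (intros E; rewrite E, Rabs_R0 in HT; lra).
set (c := infty_c (pt A) beta j) in *.
set (a := hyp_a beta gamma j). set (b := hyp_b beta gamma j).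
assert (Hc1 : Im (c + 1)%C <> 0) by (unfold Im in *; simpl; lra).
set (nu := match j with first => pt A | second => beta end).
set (ka := match j with first => gamma - beta - pt A | second => 0 end%C).
assert (Hy : canalytic (fun t => Y (rotate PI A + t)%C))
  by (now apply analytic_on_line with (1 := Han)).
assert (Hex : exists T, forall t, T < t -> Y (rotate PI A + t)%C =
  (Cexp (- nu * t + ka * ln (1 + exp (- t))) * Phi a b c (exp (- t)))%C).
{ set (a' := match j with first => pt A | second => beta end).
  set (b' := match j with first => pt A + 1 - gamma | second => beta + 1 - gamma end%C).
  destruct (pfaff a' b' c HT) as [w0 [Hw0 HP]].
  (* The bound 0 ensures [|x| > 1], the bound [- ln w0] puts [w = e^(-s)] in the range of
     [pfaff]. *)
  exists (Rmax 0 (- ln w0)). intros s Hs.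
  pose proof (Rmax_l 0 (- ln w0)). pose proof (Rmax_r 0 (- ln w0)).
  assert (Hw : 0 <= exp (- s) < w0).
  { split; [apply Rlt_le, exp_pos|]. rewrite <- (exp_ln w0 Hw0). apply exp_increasing. lra. }
  assert (He : 1 < exp s) by (rewrite <- exp_0; apply exp_increasing; lra).
  rewrite Hval; [|apply Hsig|rewrite Hx, Cmod_R, Rabs_Ropp, Rabs_pos_eq; lra].
  rewrite Hx.
  assert (Ex : (- RtoC (- exp s))%C = RtoC (exp s)) by (rewrite RtoC_opp; ring).
  assert (Ei : (/ RtoC (- exp s))%C = RtoC (- exp (- s))).
  { rewrite <- RtoC_inv by lra. f_equal. rewrite exp_Ropp. field. lra. }
  specialize (HP _ Hw).
  unfold gauss_infty. rewrite Ex, Ei. unfold a, b, c, nu, ka, a', b' in *. destruct j; simpl in *.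
  - rewrite HP, Cpower_pos, ln_exp by lra. rewrite Phi_swap, Cmult_assoc, <- Cexp_plus.
    reflexivity.
  - rewrite HP, Cpower_pos, ln_exp by lra. f_equal. f_equal. ring. }
destruct Hex as [T HTe].
rewrite (ray_solution_unique (pt A) beta gamma a b c nu ka (Phi a b c)
  (fun w => - (a * b / c) * Phi (a + 1) (b + 1) (c + 1) w)%C
  (fun w => - (a * b / c) * (- ((a + 1) * (b + 1) / (c + 1)) * Phi (a + 1 + 1) (b + 1 + 1) (c + 1 + 1) w))%C)
  with (y := fun t => Y (rotate PI A + t)%C) (T := T); auto.
- f_equal. f_equal. rewrite ln_1_exp, RtoC_plus, RtoC_opp.
  unfold nu, ka, ray_exponent. destruct j; ring.
- intros w Hw. apply Phi_family; [exact Hc|lra].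
- intros w Hw. apply is_cderiv_scal. apply Phi_family; [exact Hc1|lra].
- intros w Hw. pose proof (proj2 (Phi_family a b c w Hc (Rlt_le _ _ Hw))) as O.
  etransitivity; [|exact O]. field. split; apply Im_nz; assumption.
- unfold nu, ka, a, b, c. destruct j; [left|right]; auto.
Qed.

(** Here [0 < x < 1] lies in the disk of the series, and with [w = 1 / x - 1] one has
    [1 - x = w / (1 + w)]: the defining series is already the Pfaff form. The bound on [exp (- t)]
    is the modulus condition of [sigma_alpha]. *)
Lemma gauss_1_ray eta beta gamma j (A : Lsurf) (Y : Lsurf -> C) :
  0 < eta < PI / 2 ->
  gauss_1_continuation eta beta gamma j A Y ->
  forall t : R, t < 0 -> exp (- t) <= Cmod (pt A) ^ 2 ->
    sigma_alpha eta A (A + t)%C /\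
    Y (A + t)%C =
    (Cexp (ray_exponent (pt A) beta gamma j t (ln (1 - exp t)))
     * Phi (hyp_a beta gamma j) (hyp_b beta gamma j) (one_c (pt A) beta gamma j) (exp (- t) - 1))%C.
Proof.
intros Heta [_ Hval] t Ht Hmod.
pose proof (exp_pos t) as He. pose proof (exp_pos (- t)) as He'.
assert (He1 : exp t < 1) by (rewrite <- exp_0; apply exp_increasing; lra).
assert (He'1 : 1 < exp (- t)) by (rewrite <- exp_0; apply exp_increasing; lra).
assert (Hx : (pt (A + t) / pt A)%C = RtoC (exp t)).
{ rewrite pt_plus. field. apply pt_nz. }
assert (Hxi : (pt A / pt (A + t))%C = RtoC (exp (- t))).
{ rewrite pt_plus, exp_Ropp, RtoC_inv by lra. pose proof (pt_nz A).
  assert (RtoC (exp t) <> 0) by (apply RtoC_nz; lra). field; auto. }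
assert (E1 : (1 - RtoC (exp t))%C = RtoC (1 - exp t)) by (now rewrite RtoC_minus).
assert (Hsig : sigma_alpha eta A (A + t)%C).
{ unfold sigma_alpha. rewrite Hx, Hxi, E1, Carg_pos by lra. split; [|split; [|split]].
  - intros Ec. rewrite Ec in Hx.
    replace (pt A / pt A)%C with (RtoC 1) in Hx by (field; apply pt_nz).
    injection Hx. lra.
  - rewrite <- RtoC_minus, Cmod_R, Rabs_left by lra. lra.
  - replace (arg (A + t)%C) with (arg A) by (unfold arg, Im; simpl; ring). lra.
  - lra. }
split; [exact Hsig|].
rewrite Hval; [|exact Hsig|].
2: { rewrite Hx, <- RtoC_minus, Cmod_R, Rabs_left by lra. lra. }
rewrite Hx. unfold gauss_1. rewrite E1.
set (w := exp (- t) - 1).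
assert (Es : w / (1 + w) = 1 - exp t).
{ unfold w. rewrite exp_Ropp. field. split; lra. }
assert (El : ln (1 + w) = - t) by (unfold w; replace (1 + (exp (- t) - 1)) with (exp (- t)) by ring; apply ln_exp).
unfold Phi. rewrite Es, El, Cmult_assoc, <- Cexp_plus. destruct j; simpl.
- rewrite Cpower_pos by lra. rewrite hyp2F1_sym, hyp2F1_RtoC.
  replace (gamma + 1 - pt A - beta - (1 - beta))%C with (gamma - pt A)%C by ring.
  f_equal. f_equal. rewrite RtoC_opp. ring.
- rewrite hyp2F1_sym, hyp2F1_RtoC.
  replace (pt A + beta + 1 - gamma - (beta + 1 - gamma))%C with (pt A) by ring.
  rewrite RtoC_opp. replace (- beta * t + - beta * - t)%C with (RtoC 0) by ring.
  rewrite Cexp_0. ring.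
Qed.

(** * The limits *)

Lemma Cexp_minus_1 z : Cmod z <= 1 -> Cmod (Cexp z - 1) <= 6 * Cmod z.
Proof.
intros Hz.
(* The constant 6 is the 2 of [cderiv_bound] times [e <= 3]. *)
assert (H : Cmod (Cexp (z * RtoC 1) - Cexp (z * RtoC 0)) <= 2 * (3 * Cmod z) * (1 - 0)).
{ apply (cderiv_bound (fun t => Cexp (z * RtoC t)) (fun t => (z * 1) * Cexp (z * RtoC t))%C); [lra| |].
  - intros t _. apply is_cderiv_Cexp, is_cderiv_scal, is_cderiv_id.
  - intros t Ht. rewrite Cmult_1_r, Cmod_mult, Cmod_Cexp, Rmult_comm.
    apply Rmult_le_compat_r; [apply Cmod_ge_0|].
    apply Rle_trans with (2 := exp_le_3).
    assert (Hle : Re (z * RtoC t) <= 1).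
    { replace (Re (z * RtoC t)) with (Re z * t) by (unfold Re; simpl; ring).
      pose proof (re_le_Cmod z) as Hr. apply Rabs_le_between in Hr. nra. }
    destruct (Rle_lt_or_eq_dec _ _ Hle) as [Hlt|E]; [|rewrite E; lra].
    apply Rlt_le, exp_increasing, Hlt. }
rewrite Cmult_1_r, Cmult_0_r, Cexp_0 in H. lra.
Qed.

Lemma ln_1_plus_bounds x : Rabs x <= / 2 ->
  Rabs (ln (1 + x)) <= 2 * Rabs x /\ Rabs (ln (1 + x) - x) <= 2 * x ^ 2.
Proof.
intros Hx. pose proof Hx as Hx'. apply Rabs_le_between in Hx'.
assert (U : forall y, -1 < y -> ln (1 + y) <= y).
{ intros y Hy. rewrite <- (ln_exp y) at 2. apply ln_le; [lra|apply exp_ineq1_le]. }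
assert (H1 : ln (1 + x) <= x) by (apply U; lra).
(* This is the upper bound [U] at [- x / (1 + x)], because [1 - x / (1 + x) = 1 / (1 + x)]. *)
assert (H2 : x / (1 + x) <= ln (1 + x)).
{ assert (HU : ln (1 + - (x / (1 + x))) <= - (x / (1 + x))).
  { apply U. assert (x / (1 + x) < 1) by (apply Rlt_div_l; lra). lra. }
  replace (1 + - (x / (1 + x))) with (/ (1 + x)) in HU by (field; lra).
  rewrite ln_Rinv in HU by lra. lra. }
assert (H3 : x - x / (1 + x) <= 2 * x ^ 2).
{ replace (x - x / (1 + x)) with (x ^ 2 / (1 + x)) by (field; lra).
  apply Rle_div_l; [lra|]. pose proof (pow2_ge_0 x). nra. }
split.
- assert (x ^ 2 = Rabs x ^ 2) as Ex by (rewrite pow2_abs; reflexivity).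
  pose proof (Rabs_pos x). pose proof (Rle_abs x). pose proof (Rle_abs (- x)) as Hn.
  rewrite Rabs_Ropp in Hn.
  apply Rabs_le. split; [|lra].
  destruct (Rle_lt_dec 0 x) as [Hp|Hp].
  + rewrite Rabs_pos_eq by exact Hp.
    assert (0 <= x / (1 + x)) by (apply Rdiv_le_0_compat; lra). lra.
  + rewrite Rabs_left by exact Hp. rewrite Rabs_left in Hx by exact Hp. nra.
- apply Rabs_le. split; [lra|]. pose proof (pow2_ge_0 x). lra.
Qed.

(* With [x = - z / alpha], this is [(1 - z/alpha)^(-alpha) -> e^z] on [|z| = R]. *)
Lemma Euler_factor_limit kap R eps : 0 < R -> 0 < eps ->
  exists M, forall al x, M < Cmod al -> Rabs x = R / Cmod al ->
    Cmod (Cexp (kap * ln (1 + x) - al * (ln (1 + x) - x)) - 1) <= eps.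
Proof.
intros HR Heps. set (L := 2 * Cmod kap * R + 2 * R ^ 2).
assert (HL : 0 <= L) by (unfold L; pose proof (Cmod_ge_0 kap); nra).
(* The three summands ensure in turn [|x| <= 1/2], an exponent of modulus at most 1, and the final
   bound [eps]. *)
exists (2 * R + L + 6 * L / eps). intros al x HM Hx.
assert (Hq : 0 <= 6 * L / eps) by (apply Rdiv_le_0_compat; lra).
assert (Ha : 0 < Cmod al) by lra.
assert (Hx2 : Rabs x <= / 2).
{ rewrite Hx. apply Rle_div_l; lra. }
destruct (ln_1_plus_bounds x Hx2) as [B1 B2].
assert (Hz : Cmod (kap * ln (1 + x) - al * (ln (1 + x) - x)) <= L / Cmod al).
{ eapply Rle_trans; [apply Cmod_triangle|]. rewrite Cmod_opp, !Cmod_mult, <- RtoC_minus, !Cmod_R.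
  replace (L / Cmod al) with (Cmod kap * (2 * (R / Cmod al)) + Cmod al * (2 * (R / Cmod al) ^ 2))
    by (unfold L; field; lra).
  rewrite <- Hx, pow2_abs. apply Rplus_le_compat; apply Rmult_le_compat_l; auto using Cmod_ge_0. }
assert (Hz1 : L / Cmod al <= 1) by (apply Rle_div_l; lra).
eapply Rle_trans; [apply Cexp_minus_1; lra|].
apply Rle_trans with (6 * (L / Cmod al)); [lra|].
replace (6 * (L / Cmod al)) with (6 * L / Cmod al) by (field; lra).
apply Rle_div_l; [exact Ha|].
assert (E : 6 * L = 6 * L / eps * eps) by (field; lra).
rewrite E, (Rmult_comm eps). apply Rmult_le_compat_r; lra.
Qed.

(** [Q] may depend on [d]: this turns the iterated limit, [alpha] first and [R] afterwards, into a
    single one. *)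
Lemma limit_of_approximations (F : (Lsurf -> Prop) -> Prop) {FF : Filter F} (X : Lsurf -> C) :
  (forall d, 0 < d -> exists Q : Lsurf -> C,
     F (fun al => Cmod (X al * Q al - 1) <= d /\ Cmod (Q al - 1) <= d)) ->
  filterlim X F (locally (RtoC 1)).
Proof.
intros H P [e He]. assert (e0 := cond_pos e).
(* Then [|Q| >= 1/2], hence [|X - 1| <= 4 d <= e / 2]. *)
set (d := Rmin (/ 2) (e / 8)).
assert (Hd : 0 < d) by (apply Rmin_pos; lra).
assert (Hd1 : d <= / 2) by apply Rmin_l. assert (Hd2 : d <= e / 8) by apply Rmin_r.
destruct (H d Hd) as [Q HQ]. unfold filtermap. revert HQ. apply filter_imp.
intros al [H1 H2]. apply He. apply C_NormedModule_mixin_compat1.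
change (Cmod (X al - 1) < e).
assert (HQ : / 2 <= Cmod (Q al)).
{ pose proof (Cmod_triangle (Q al) (1 - Q al)) as Ht.
  replace (Q al + (1 - Q al))%C with (RtoC 1) in Ht by ring.
  replace (1 - Q al)%C with (- (Q al - 1))%C in Ht by ring.
  rewrite Cmod_opp, Cmod_1 in Ht. lra. }
assert (HX : Cmod (X al - 1) * Cmod (Q al) <= d + d).
{ rewrite <- Cmod_mult.
  replace ((X al - 1) * Q al)%C with ((X al * Q al - 1) + - (Q al - 1))%C by ring.
  eapply Rle_trans; [apply Cmod_triangle|]. rewrite Cmod_opp. lra. }
pose proof (Cmod_ge_0 (X al - 1)). nra.
Qed.

Lemma compact_set_singleton (z : C) : compact_set (fun u => u = z).
Proof.
intros F _ Hc. destruct (Hc z eq_refl) as [U [FU Uz]].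
exists (U :: nil). split.
- intros V [<-|[]]. exact FU.
- intros u ->. exists U. split; [now left|exact Uz].
Qed.

(** The offset [theta] from [arg alpha] is [PI] for the solutions at infinity and 0 for those at 1.
    The point does not move with [|alpha|]. *)
Definition ray_point (s : ray_sign) (theta r : R) : Lsurf := (ln r, ray_arg s + theta).

Lemma kummer_asymptotic_ray beta gamma j k y s theta :
  kummer_solution beta gamma j k y -> ray_arg s + theta = IZR k * PI + PI / 2 ->
  exists B M, forall R, 0 < R -> M < R ->
    Cmod (y (ray_point s theta R) / kummer_prefactor beta gamma j (ray_point s theta R) - 1) <= B / R.
Proof.
intros [_ [_ Has]] Hth. pose proof PI_RGT_0.
(* Order 0 of the expansion on the bisector of the sector: the leading term is 1 and the error is
   [B / R]. *)
destruct (Has (ray_arg s + theta) (ray_arg s + theta) ltac:(lra) ltac:(lra) 0%nat) as [B [M HB]].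
exists B, M. intros R HR HM.
assert (Em : modulus (ray_point s theta R) = R) by (apply exp_ln, HR).
specialize (HB (ray_point s theta R)). rewrite Em in HB.
specialize (HB ltac:(unfold arg; simpl; lra) HM).
rewrite pow_1 in HB.
rewrite sum_O in HB.
replace (kummer_coef beta gamma j 0 / pt (ray_point s theta R) ^ 0)%C with (RtoC 1) in HB; [exact HB|].
destruct j; simpl; field.
Qed.

Lemma kummer_prefactor_nz beta gamma j z : kummer_prefactor beta gamma j z <> 0.
Proof.
destruct j; simpl; unfold Lpow.
- apply Cmult_neq_0; apply Cexp_nz.
- intros E. apply (Cexp_nz (- beta * z)).
  replace (Cexp (- beta * z)) with (- - Cexp (- beta * z))%C by ring. rewrite E. ring.
Qed.

(* [Y] agrees on the ray with [X] times the Kummer prefactor up to a factor [Q] that is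
   [1 + O(1/R)] for large [alpha]; comparing with the Kummer asymptotics at [|z| = R] and
   letting [R] tend to infinity last gives [X -> 1]. *)
Lemma scalar_limit beta gamma eta j k s theta (D : Lsurf -> Lsurf -> Prop)
    (Y : Lsurf -> Lsurf -> C) (kk X : Lsurf -> C) (y : Lsurf -> C) (K R0 : R) :
  0 < eta < PI / 2 ->
  kummer_solution beta gamma j k y ->
  ray_arg s + theta = IZR k * PI + PI / 2 ->
  uniform_limit s D (S_tilde eta k) (fun al z => Y al z * kk al)%C y ->
  0 <= K ->
  (forall R, 0 < R -> R0 <= R -> exists Q : Lsurf -> C, ray_infty s (fun al =>
     D al (ray_point s theta R)
     /\ (Y al (ray_point s theta R) * kk al
         = X al * Q al * kummer_prefactor beta gamma j (ray_point s theta R))%C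
     /\ Cmod (Q al - 1) <= K / R)) ->
  filterlim X (ray_infty s) (locally (RtoC 1)).
Proof.
intros Heta Hy Hth Hlim HK HQ. pose proof PI_RGT_0.
destruct (kummer_asymptotic_ray _ _ _ _ _ _ _ Hy Hth) as [B [M HB]].
apply limit_of_approximations; [apply filter_filter'|]. intros d Hd.
(* Large enough for both thresholds, for [K / R <= d] and for [B / R <= d / 2]. *)
set (R := 1 + Rabs R0 + Rabs M + 2 * Rabs B / d + K / d).
assert (P1 : 0 <= 2 * Rabs B / d) by (apply Rdiv_le_0_compat; [pose proof (Rabs_pos B)|]; lra).
assert (P2 : 0 <= K / d) by (apply Rdiv_le_0_compat; lra).
pose proof (Rle_abs R0). pose proof (Rle_abs M). pose proof (Rle_abs B).
pose proof (Rabs_pos R0). pose proof (Rabs_pos M). pose proof (Rabs_pos B).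
assert (HR : 0 < R) by (unfold R; lra).
assert (HKR : K / R <= d).
{ apply Rle_div_l; [exact HR|]. replace K with (K / d * d) at 1 by (field; lra).
  rewrite (Rmult_comm d). apply Rmult_le_compat_r; unfold R; lra. }
assert (HBR : B / R <= d / 2).
{ apply Rle_div_l; [exact HR|]. apply Rle_trans with (Rabs B); [assumption|].
  replace (Rabs B) with (2 * Rabs B / d * (d / 2)) at 1 by (field; lra).
  rewrite (Rmult_comm (d / 2)). apply Rmult_le_compat_r; unfold R; lra. }
specialize (HB R HR ltac:(unfold R; lra)).
destruct (HQ R HR ltac:(unfold R; lra)) as [Q HQ']. exists Q.
set (z := ray_point s theta R) in *. set (g := kummer_prefactor beta gamma j z) in *.
assert (g0 : g <> 0) by apply kummer_prefactor_nz.
assert (gp : 0 < Cmod g) by now apply Cmod_gt_0.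
assert (Hz : forall u, u = z -> S_tilde eta k u).
{ intros u ->. unfold S_tilde, arg, z, ray_point. simpl. lra. }
(* [R] is now fixed, so the tolerance may contain the prefactor [g], by which the difference is
   divided later. *)
assert (Hl := Hlim _ (compact_set_singleton z) Hz (d / 2 * Cmod g) ltac:(nra)).
generalize (filter_and _ _ HQ' Hl). apply filter_imp.
intros al [[HD [HYX HQ1]] HL]. split; [|lra].
specialize (HL z eq_refl HD). rewrite HYX in HL.
replace (X al * Q al - 1)%C with ((X al * Q al * g - y z) / g + (y z / g - 1))%C by (field; exact g0).
eapply Rle_trans; [apply Cmod_triangle|]. rewrite Cmod_div by exact g0.
assert (Cmod (X al * Q al * g - y z) / Cmod g <= d / 2) by (apply Rle_div_l; lra).
lra.
Qed.

Lemma ray_pt s (A : Lsurf) : arg A = ray_arg s ->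
  Re (pt A) = 0 /\ Rabs (Im (pt A)) = modulus A /\ Cmod (pt A) = modulus A.
Proof.
intros HA. unfold pt, modulus. rewrite Cmod_Cexp. unfold Cexp. simpl.
change (Im A) with (arg A). rewrite HA.
pose proof (exp_pos (Re A)).
destruct s; simpl; rewrite ?cos_neg, ?sin_neg, cos_PI2, sin_PI2;
  (split; [ring|split; [|reflexivity]]).
- rewrite Rmult_1_r. apply Rabs_pos_eq. lra.
- rewrite Rabs_left by lra. ring.
Qed.

Lemma ray_infty_large s M : ray_infty s (fun al => arg al = ray_arg s /\ M < modulus al).
Proof. exists M. auto. Qed.

(** Here [m] stands for [|alpha|]: from [w <= m / R] and [m <= 2 |Im c|] one gets
    [w / |Im c| <= 2 / R], free of [alpha]. *)
Lemma Phi_bound_ray (a b : C) (cr : R) :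
  exists K R0, 0 <= K /\ 1 <= R0 /\ forall R m c w,
    R0 <= R -> Re c = cr -> 1 <= Rabs (Im c) -> m <= 2 * Rabs (Im c) -> 0 <= w <= m / R ->
    Cmod (Phi a b c w - 1) <= K / R.
Proof.
destruct (Phi_bound a b cr) as [K [R0 [HK [HR0 HB]]]].
exists (2 * K), (2 * R0). split; [lra|split; [lra|]].
intros R m c w HR Ec HT Hm Hw.
set (T := Rabs (Im c)) in *.
assert (HwR : w * R <= m) by (apply Rle_div_r; lra).
eapply Rle_trans; [apply (HB c w Ec HT (proj1 Hw))|].
- assert (w * (2 * R0) <= w * R) by (apply Rmult_le_compat_l; lra). fold T. lra.
- fold T. unfold Rdiv at 2. rewrite (Rmult_comm 2), Rmult_assoc. apply Rmult_le_compat_l; [exact HK|].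
  apply Rle_div_l; [lra|]. apply Rmult_le_reg_r with R; [lra|].
  replace (2 * / R * T * R) with (2 * T) by (field; lra). lra.
Qed.

Lemma nonresonant_large s (beta gamma : C) (A : Lsurf) :
  (forall n : Z, gamma <> IZR n) -> arg A = ray_arg s ->
  Rabs (Im beta) + Rabs (Im gamma) < modulus A -> nonresonant (pt A) beta gamma.
Proof.
intros Hg HA HM n. destruct (ray_pt s A HA) as [_ [HI _]].
rewrite <- HI in HM.
assert (Ht := Rabs_triang_inv (Im (pt A)) (Im gamma - Im beta)).
pose proof (Rabs_triang (Im gamma) (- Im beta)) as Ht'. rewrite Rabs_Ropp in Ht'.
pose proof (Rabs_pos (Im beta)). pose proof (Rabs_pos (Im gamma)).
split; [apply Hg|split].
- intros E. apply (f_equal Im) in E.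
  change (Im gamma + - Im (pt A) + - Im beta = 0) in E.
  replace (Im (pt A)) with (Im gamma + - Im beta) in HM by lra. lra.
- intros E. apply (f_equal Im) in E. change (Im (pt A) + - Im beta = 0) in E.
  replace (Im (pt A)) with (Im beta) in HM by lra. lra.
Qed.

(** * Separating the normalised scalars from the Kummer prefactor *)

Definition scaled (beta gamma : C) (j : index) (theta : R) (k : Lsurf -> C) (A : Lsurf) : C :=
  match j with
  | first => k A * Lpow (rotate theta A) (gamma - beta)
  | second => - k A * Lpow (rotate theta A) beta
  end%C.

(** What is left of [(1 + x)^(gamma - beta - alpha)] once [e^z = e^(- alpha x)] has been split off,
    where [x = - z / alpha]. *)
Definition Euler_factor (alpha beta gamma : C) (j : index) (x : R) : C :=
  match j with
  | first => Cexp ((gamma - beta) * ln (1 + x) - alpha * (ln (1 + x) - x))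
  | second => 1
  end%C.

Lemma Euler_factor_bound beta gamma j R eps : 0 < R -> 0 < eps ->
  exists M, forall al x, M < Cmod al -> Rabs x = R / Cmod al ->
    Cmod (Euler_factor al beta gamma j x - 1) <= eps.
Proof.
intros HR He. destruct j; simpl.
- now apply Euler_factor_limit.
- exists 0. intros _ _ _ _. replace (1 - 1)%C with (RtoC 0) by ring. rewrite Cmod_0. lra.
Qed.

(** Codes are logarithms, so every power is [Cexp] of a linear expression and the claim compares
    exponents, with no choice of branch. *)
Lemma ray_value_scaled beta gamma j theta (k : Lsurf -> C) (A z : Lsurf) (t x : R) (F : C) :
  z = (rotate theta A + t)%C -> pt z = (- pt A * x)%C ->
  (Cexp (ray_exponent (pt A) beta gamma j t (ln (1 + x))) * F * k A
   = scaled beta gamma j theta k A * (Euler_factor (pt A) beta gamma j x * F)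
     * kummer_prefactor beta gamma j z)%C.
Proof.
intros Hz Hp. destruct j; simpl; unfold Lpow.
- rewrite Hp, Hz.
  replace (Cexp (- (gamma - beta) * t + (gamma - beta - pt A) * ln (1 + x)))%C
    with (Cexp ((gamma - beta) * rotate theta A)
      * Cexp ((gamma - beta) * ln (1 + x) - pt A * (ln (1 + x) - x))
      * (Cexp (- pt A * x) * Cexp ((beta - gamma) * (rotate theta A + t))))%C; [ring|].
  rewrite <- !Cexp_plus. f_equal. ring.
- rewrite Hz.
  replace (Cexp (- beta * t))%C
    with (Cexp (beta * rotate theta A) * Cexp (- beta * (rotate theta A + t)))%C; [ring|].
  rewrite <- Cexp_plus. f_equal. ring.
Qed.

Lemma factor_bound (u v : C) (d e : R) :
  Cmod (u - 1) <= d -> d <= 1 -> Cmod (v - 1) <= e -> Cmod (u * v - 1) <= d + 2 * e.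
Proof.
intros Hu Hd Hv.
replace (u * v - 1)%C with ((u - 1) + (v - 1) * ((u - 1) + 1))%C by ring.
eapply Rle_trans; [apply Cmod_triangle|]. rewrite Cmod_mult.
pose proof (Cmod_triangle (u - 1) 1) as Ht. rewrite Cmod_1 in Ht.
pose proof (Cmod_ge_0 (v - 1)). pose proof (Cmod_ge_0 (u - 1 + 1)). nra.
Qed.

(** Common argument for both singular points: [cf] gives [c], [xf] gives [- z / alpha] from
    [R / |alpha|], and [wf] gives [w] from [|alpha| / R], namely this quotient itself at infinity
    and the quotient minus 1 at 1. *)
Lemma ray_scalar_limit beta gamma eta j k s theta (D : Lsurf -> Lsurf -> Prop)
    (Y : Lsurf -> Lsurf -> C) (kk : Lsurf -> C) (y : Lsurf -> C)
    (cf : C -> C) (c0 : C) (xf wf : R -> R) :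
  0 < eta < PI / 2 ->
  kummer_solution beta gamma j k y ->
  ray_arg s + theta = IZR k * PI + PI / 2 ->
  uniform_limit s D (S_tilde eta k) (fun al z => Y al z * kk al)%C y ->
  (forall al, cf al = al + c0 \/ cf al = - al + c0)%C ->
  (forall u, 0 < u -> Rabs (xf u) = u) ->
  (forall u, 1 < u -> 0 <= wf u <= u) ->
  (exists M0, forall R, 0 < R -> exists M, forall A, arg A = ray_arg s ->
     let m := modulus A in M0 < m -> M < m ->
     D A (ray_point s theta R) /\ pt (ray_point s theta R) = (- pt A * xf (R / m)%R)%C /\
     Y A (ray_point s theta R) =
      (Cexp (ray_exponent (pt A) beta gamma j (ln R - Re A)%R (ln (1 + xf (R / m)%R)))
       * Phi (hyp_a beta gamma j) (hyp_b beta gamma j) (cf (pt A)) (wf (m / R)%R))%C) ->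
  filterlim (scaled beta gamma j theta kk) (ray_infty s) (locally (RtoC 1)).
Proof.
intros Heta Hy Hth Hlim Hcf Hxf Hwf [M0 HY].
destruct (Phi_bound_ray (hyp_a beta gamma j) (hyp_b beta gamma j) (Re c0)) as [K [R0 [HK [HR0 HB]]]].
(* The 1 is for the Euler factor, taken with tolerance [/ R]; [2 * K] is for [Phi], doubled by
   [factor_bound]. *)
apply scalar_limit with (K := 1 + 2 * K) (R0 := R0) (1 := Heta) (2 := Hy) (3 := Hth) (4 := Hlim);
  [lra|].
intros R HR HRR0.
assert (HiR : 0 < / R) by now apply Rinv_0_lt_compat.
assert (HiR1 : / R <= 1) by (rewrite <- Rinv_1; apply Rinv_le_contravar; lra).
destruct (Euler_factor_bound beta gamma j R (/ R) HR HiR) as [M HM].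
destruct (HY R HR) as [M' HM'].
set (z := ray_point s theta R).
exists (fun A => Euler_factor (pt A) beta gamma j (xf (R / modulus A)%R)
  * Phi (hyp_a beta gamma j) (hyp_b beta gamma j) (cf (pt A)) (wf (modulus A / R)%R))%C.
pose proof (ray_infty_large s (Rmax (Rmax M0 M') (Rmax M (2 + R + 2 * Rabs (Im c0))))) as HF.
revert HF. apply filter_imp. intros A [HA Hm].
pose proof (Rmax_l (Rmax M0 M') (Rmax M (2 + R + 2 * Rabs (Im c0)))).
pose proof (Rmax_r (Rmax M0 M') (Rmax M (2 + R + 2 * Rabs (Im c0)))).
pose proof (Rmax_l M0 M'). pose proof (Rmax_r M0 M').
pose proof (Rmax_l M (2 + R + 2 * Rabs (Im c0))). pose proof (Rmax_r M (2 + R + 2 * Rabs (Im c0))).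
pose proof (Rabs_pos (Im c0)).
destruct (HM' A HA ltac:(lra) ltac:(lra)) as [HD [Hp HYv]].
fold z in HD, Hp, HYv. set (m := modulus A) in *.
assert (Hm0 : 0 < m) by lra.
split; [exact HD|split].
- rewrite HYv. apply ray_value_scaled; [|exact Hp].
  unfold z, ray_point, rotate. apply C_eq; unfold Re, Im in *; simpl.
  + ring.
  + change (snd A) with (arg A). rewrite HA. ring.
- destruct (ray_pt s A HA) as [HRe [HIm HC]]. fold m in HIm, HC.
  replace ((1 + 2 * K) / R) with (/ R + 2 * (K / R)) by (field; lra).
  apply factor_bound; [|exact HiR1|].
  + apply HM; [rewrite HC; lra|]. rewrite HC. apply Hxf. apply Rdiv_lt_0_compat; lra.
  (* On the rays [Re alpha = 0], so [Re c] stays equal to [Re c0] and one pair of constants serves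
     for all [alpha]. *)
  + assert (Hc : Re (cf (pt A)) = Re c0 /\ m <= 2 * Rabs (Im (cf (pt A))) /\ 1 <= Rabs (Im (cf (pt A)))).
    { destruct (Hcf (pt A)) as [-> | ->].
      - change (Re (pt A + c0)%C) with (Re (pt A) + Re c0).
        change (Im (pt A + c0)%C) with (Im (pt A) + Im c0).
        pose proof (Rabs_triang_inv (Im (pt A)) (- Im c0)) as Ht.
        rewrite Rabs_Ropp in Ht. unfold Rminus in Ht. rewrite Ropp_involutive in Ht. lra.
      - change (Re (- pt A + c0)%C) with (- Re (pt A) + Re c0).
        change (Im (- pt A + c0)%C) with (- Im (pt A) + Im c0).
        pose proof (Rabs_triang_inv (- Im (pt A)) (- Im c0)) as Ht.
        rewrite !Rabs_Ropp in Ht. unfold Rminus in Ht. rewrite Ropp_involutive in Ht. lra. }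
    destruct Hc as [C1 [C2 C3]].
    apply HB with (m := m); try assumption.
    apply Hwf. apply Rlt_div_r; lra.
Qed.

Lemma exp_ray_parameter R (A : Lsurf) : 0 < R -> exp (ln R - Re A) = R / modulus A.
Proof. intros HR. unfold Rminus, modulus. rewrite exp_plus, exp_Ropp, exp_ln by exact HR. reflexivity. Qed.

Lemma exp_opp_ray_parameter R (A : Lsurf) : 0 < R -> exp (- (ln R - Re A)) = modulus A / R.
Proof.
intros HR. rewrite exp_Ropp, exp_ray_parameter by exact HR.
pose proof (exp_pos (Re A)). unfold modulus. field. lra.
Qed.

Lemma kinf_limit (beta gamma : C) eta s j k (Y : Lsurf -> Lsurf -> C) (kk y : Lsurf -> C) :
  (forall n : Z, gamma <> IZR n) -> 0 < eta < PI / 2 ->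
  (forall al, arg al = ray_arg s -> nonresonant (pt al) beta gamma ->
     gauss_infty_continuation eta beta gamma j al (Y al)) ->
  kummer_solution beta gamma j k y ->
  ray_arg s + PI = IZR k * PI + PI / 2 ->
  uniform_limit s (sigma_infty eta) (S_tilde eta k) (fun al z => Y al z * kk al)%C y ->
  filterlim (scaled beta gamma j PI kk) (ray_infty s) (locally (RtoC 1)).
Proof.
intros Hg Heta HY Hy Hth Hlim.
apply ray_scalar_limit with (cf := fun al => infty_c al beta j)
  (c0 := match j with first => 1 - beta | second => beta + 1 end%C)
  (xf := fun u => u) (wf := fun u => u) (1 := Heta) (2 := Hy) (3 := Hth) (4 := Hlim).
- intros al. destruct j; [left|right]; simpl; ring.
- intros u Hu. apply Rabs_pos_eq. lra.
- intros u Hu. lra.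
(* Beyond this modulus the equation is nonresonant and [|Im c| >= 1]. *)
- exists (Rabs (Im beta) + Rabs (Im gamma) + 1). intros R HR. exists 0.
  intros A HA m Hm _.
  assert (HT : 1 <= Rabs (Im (infty_c (pt A) beta j))).
  { destruct (ray_pt s A HA) as [_ [HI _]]. fold m in HI.
    pose proof (Rabs_pos (Im gamma)). pose proof (Rabs_triang_inv (Im (pt A)) (Im beta)) as Ht.
    replace (Rabs (Im (infty_c (pt A) beta j))) with (Rabs (Im (pt A) - Im beta)); [lra|].
    destruct j; simpl; [|rewrite <- Rabs_Ropp]; f_equal; unfold Im; simpl; ring. }
  assert (HN : nonresonant (pt A) beta gamma).
  { apply nonresonant_large with (s := s); auto. fold m. lra. }
  pose proof (gauss_infty_ray eta beta gamma j A (Y A) Heta HT (HY A HA HN) (ln R - Re A)) as [Hsig Hval].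
  assert (Ez : (rotate PI A + RtoC (ln R - Re A))%C = ray_point s PI R).
  { unfold ray_point, rotate. apply C_eq; unfold Re, Im in *; simpl; [ring|].
    change (snd A) with (arg A). rewrite HA. ring. }
  assert (Hp := pt_plus (rotate PI A) (ln R - Re A)).
  rewrite Ez in Hsig, Hval, Hp. rewrite exp_ray_parameter in Hval, Hp by exact HR.
  rewrite exp_opp_ray_parameter in Hval by exact HR. fold m in Hval, Hp.
  split; [exact Hsig|split; [|exact Hval]].
  rewrite Hp, pt_rotate_PI. ring.
Qed.

Lemma k1_limit (beta gamma : C) eta s j k (Y : Lsurf -> Lsurf -> C) (kk y : Lsurf -> C) :
  (forall n : Z, gamma <> IZR n) -> 0 < eta < PI / 2 ->
  (forall al, arg al = ray_arg s -> nonresonant (pt al) beta gamma ->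
     gauss_1_continuation eta beta gamma j al (Y al)) ->
  kummer_solution beta gamma j k y ->
  ray_arg s + 0 = IZR k * PI + PI / 2 ->
  uniform_limit s (sigma_alpha eta) (S_tilde eta k) (fun al z => Y al z * kk al)%C y ->
  filterlim (scaled beta gamma j 0 kk) (ray_infty s) (locally (RtoC 1)).
Proof.
intros Hg Heta HY Hy Hth Hlim.
apply ray_scalar_limit with (cf := fun al => one_c al beta gamma j)
  (c0 := match j with first => gamma + 1 - beta | second => beta + 1 - gamma end%C)
  (xf := fun u => - u) (wf := fun u => u - 1) (1 := Heta) (2 := Hy) (3 := Hth) (4 := Hlim).
- intros al. destruct j; [right|left]; simpl; ring.
- intros u Hu. rewrite Rabs_Ropp. apply Rabs_pos_eq. lra.
- intros u Hu. lra.
(* From [m > R] follows [x < 1]; from [m > / R] follows [m / R <= m^2], the modulus condition of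
   [sigma_alpha]. *)
- exists (Rabs (Im beta) + Rabs (Im gamma)). intros R HR. exists (R + / R).
  intros A HA m Hm HmR.
  assert (HiR : 0 < / R) by now apply Rinv_0_lt_compat.
  assert (HN : nonresonant (pt A) beta gamma) by now apply nonresonant_large with (s := s).
  assert (Ht : ln R - Re A < 0).
  { apply exp_lt_inv. rewrite exp_ray_parameter, exp_0 by exact HR. fold m. apply Rlt_div_l; lra. }
  assert (Hsq : exp (- (ln R - Re A)) <= Cmod (pt A) ^ 2).
  { rewrite exp_opp_ray_parameter by exact HR. destruct (ray_pt s A HA) as [_ [_ ->]]. fold m.
    simpl. rewrite Rmult_1_r. unfold Rdiv. apply Rmult_le_compat_l; lra. }
  pose proof (gauss_1_ray eta beta gamma j A (Y A) Heta (HY A HA HN) _ Ht Hsq) as [Hsig Hval].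
  assert (Ez : (A + RtoC (ln R - Re A))%C = ray_point s 0 R).
  { unfold ray_point. apply C_eq; unfold Re, Im in *; simpl; [ring|].
    change (snd A) with (arg A). rewrite HA. ring. }
  assert (Hp := pt_plus A (ln R - Re A)).
  rewrite Ez in Hsig, Hval, Hp. rewrite exp_ray_parameter in Hval, Hp by exact HR.
  rewrite exp_opp_ray_parameter in Hval by exact HR. fold m in Hval, Hp.
  split; [exact Hsig|split; [|exact Hval]].
  rewrite Hp, RtoC_opp. ring.
Qed.

Lemma scaled_0 beta gamma j k A :
  scaled beta gamma j 0 k A = match j with
    | first => k A * Lpow A (gamma - beta) | second => - k A * Lpow A beta end%C.
Proof.
assert (E : rotate 0 A = A) by (unfold rotate; ring).
unfold scaled. now rewrite E.
Qed.

Theorem theorem3 (beta gamma : C) (eta : R)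
    (* continuations of y_j^{(1)}(z/alpha), y_j^{(infinity)}(z/alpha): index, alpha, z *)
    (Y1 Yinf : index -> Lsurf -> Lsurf -> C)
    (* Kummer solutions: index, sector, z *)
    (Yt : index -> Z -> Lsurf -> C)
    (* the scalars k_{j,1}^{+-}(alpha), k_{j,infinity}^{+-}(alpha) *)
    (k1 kinf : ray_sign -> index -> Lsurf -> C)
    (hgamma : forall n : Z, gamma <> IZR n)
    (hbeta : ((beta - 1) * (beta - gamma))%C <> 0)
    (heta : 0 < eta < PI / 2)
    (hY1 : forall (s : ray_sign) (j : index) (alpha : Lsurf),
        arg alpha = ray_arg s -> nonresonant (pt alpha) beta gamma ->
        gauss_1_continuation eta beta gamma j alpha (Y1 j alpha))
    (hYinf : forall (s : ray_sign) (j : index) (alpha : Lsurf),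
        arg alpha = ray_arg s -> nonresonant (pt alpha) beta gamma ->
        gauss_infty_continuation eta beta gamma j alpha (Yinf j alpha))
    (hYt : forall (j : index) (k : Z), kummer_solution beta gamma j k (Yt j k))
    (hlim1m : forall j : index,
        uniform_limit minus_ray (sigma_alpha eta) (S_tilde eta (-1))
          (fun alpha z => Y1 j alpha z * k1 minus_ray j alpha)%C (Yt j (-1)%Z))
    (hliminfm : forall j : index,
        uniform_limit minus_ray (sigma_infty eta) (S_tilde eta 0)
          (fun alpha z => Yinf j alpha z * kinf minus_ray j alpha)%C (Yt j 0%Z))
    (hlim1p : forall j : index,
        uniform_limit plus_ray (sigma_alpha eta) (S_tilde eta 0)
          (fun alpha z => Y1 j alpha z * k1 plus_ray j alpha)%C (Yt j 0%Z))
    (hliminfp : forall j : index,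
        uniform_limit plus_ray (sigma_infty eta) (S_tilde eta 1)
          (fun alpha z => Yinf j alpha z * kinf plus_ray j alpha)%C (Yt j 1%Z)) :
  forall s : ray_sign,
    filterlim (fun alpha => kinf s first alpha * Lpow (rotate PI alpha) (gamma - beta))%C
      (ray_infty s) (locally (RtoC 1))
    /\ filterlim (fun alpha => - kinf s second alpha * Lpow (rotate PI alpha) beta)%C
      (ray_infty s) (locally (RtoC 1))
    /\ filterlim (fun alpha => k1 s first alpha * Lpow alpha (gamma - beta))%C
      (ray_infty s) (locally (RtoC 1))
    /\ filterlim (fun alpha => - k1 s second alpha * Lpow alpha beta)%C
      (ray_infty s) (locally (RtoC 1)).
Proof.
intros s.
(* In each case [k] is the index for which [arg alpha + theta] is the bisector [k PI + PI / 2]. *)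
assert (HI : forall j, filterlim (scaled beta gamma j PI (kinf s j)) (ray_infty s) (locally (RtoC 1))).
{ intros j. destruct s.
  - apply kinf_limit with (k := 1%Z) (1 := hgamma) (2 := heta) (4 := hYt j 1%Z) (6 := hliminfp j).
    + intros al. apply hYinf.
    + simpl. lra.
  - apply kinf_limit with (k := 0%Z) (1 := hgamma) (2 := heta) (4 := hYt j 0%Z) (6 := hliminfm j).
    + intros al. apply hYinf.
    + simpl. lra. }
assert (H1 : forall j, filterlim (scaled beta gamma j 0 (k1 s j)) (ray_infty s) (locally (RtoC 1))).
{ intros j. destruct s.
  - apply k1_limit with (k := 0%Z) (1 := hgamma) (2 := heta) (4 := hYt j 0%Z) (6 := hlim1p j).
    + intros al. apply hY1.
    + simpl. lra.
  - apply k1_limit with (k := (-1)%Z) (1 := hgamma) (2 := heta) (4 := hYt j (-1)%Z) (6 := hlim1m j).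
    + intros al. apply hY1.
    + simpl. lra. }
split; [exact (HI first)|split; [exact (HI second)|split]].
- apply filterlim_ext with (2 := H1 first). intros A. apply (scaled_0 beta gamma first).
- apply filterlim_ext with (2 := H1 second). intros A. apply (scaled_0 beta gamma second).
Qed.
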